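(* Let $T:[-1,1]\to[-1,1]$ be a piecewise $C^1$ map, nonsingular with respect to Lebesgue measure $m$, such that: (D1) $T$ admits a unique absolutely continuous invariant probability measure $\mu_0$, with density $f_0$; (D2) $\int_{-1}^1\ln(|T'|)\,d\mu_0>0$; (D3) $\ln(|T'|)\in L^p([-1,1])$ for some $p>1$. For $\xi>0$ let $\mu_\xi$ be a stationary measure of the annealed transfer operator $L_\xi$ associated with $T$ and the noise kernel $\rho$ (i.e. a probability measure with $L_\xi\mu_\xi=\mu_\xi$), and for $\xi\ge 0$ let $$\lambda(\xi)=\int_{-1}^1\ln(|T'|)\,d\mu_\xi .$$ Suppose moreover that: (R1) there exists $\xi_0>0$ such that $\lambda(\xi)$ is well defined and continuous on $[0,\xi_0)$; (R2) there exist $\xi_1\in[0,\xi_0)$, $C>0$ and $\theta<1$ such that $\|P_{\xi_1}^n|_{\mathcal U_0}\|_{BV\to BV}\le C\theta^n$ for all $n$, where $P_{\xi_1}$ is the annealed Perron-Frobenius operator with noise amplitude $\xi_1$ and $\mathcal U_0$ is the space of functions in $BV([-1,1])$ with zero average; (R3) $-\infty<\int_{-1}^1\ln(|T'(x)|)\,\frac{dm}{2}<0$; (R4) the noise kernel $\rho$ is a mother noise kernel. Then the function $\lambda(\xi)$ is well defined and continuous for all $\xi\ge 0$, and $T$ exhibits Noise Induced Order.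
   Context: $m$ is Lebesgue measure. For an interval $[a,b]$, $\mathrm{Var}_{[a,b]}(\phi)=\sup\sum_i|\phi(x_{i+1})-\phi(x_i)|$ over all partitions of $[a,b]$, and $\|\phi\|_{BV}=\|\phi\|_{L^1}+\mathrm{Var}(\phi)$. $T$ is nonsingular if $m(A)=0$ implies $m(T^{-1}A)=0$. The transfer operator of $T$ acts on signed measures on $[-1,1]$ by $L\mu(A)=\mu(T^{-1}A)$; the Perron-Frobenius operator $P:L^1([-1,1])\to L^1([-1,1])$ is defined by $L(f\,m)=(Pf)\,m$. A mother noise kernel is a function $\rho:\mathbb R\to\mathbb R$ of bounded variation with $\rho(x)\ge c>0$ for all $x\in[-1,1]$ (for some constant $c$), $\rho(x)=0$ outside $[-1,1]$ and $\int_{-1}^1\rho\,dm=1$. For $\xi>0$, $\rho_\xi(x)=\frac1\xi\rho(x/\xi)$; $\xi$ is the noise amplitude. A hat denotes extension by zero to $\mathbb R$ of a function or measure. The convolution of $\hat\rho_\xi$ with a measure $\hat\mu$ is $(\hat\rho_\xi*\hat\mu)(A)=\int_{[-\xi,\xi]}\rho_\xi(y)\hat\mu(A-y)\,dm(y)$. A boundary condition $\pi:\mathbb R\to[-1,1]$ is fixed, which is either periodic, $\pi_P(x)=x \bmod 2$ (representatives in $(-1,1]$), or reflecting, $\pi_R(x)=\min_{i\in\mathbb Z}|(x+1)-4i|-1$; $\pi_*\mu(A)=\mu(\pi^{-1}(A))$, and $\pi_*$ also denotes the induced map on densities. For $\xi>0$ the annealed transfer operator is $L_\xi\mu=\pi_*(\hat\rho_\xi*\widehat{L\mu})$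 and the annealed Perron-Frobenius operator is $P_\xi f=\pi_*(\hat\rho_\xi*\widehat{Pf})$ on $L^1([-1,1])$. For $\xi=0$, $L_0=L$, $P_0=P$, and $\mu_0$ is the measure in (D1). For $\xi>0$, $\lambda(\xi)$ is well defined when $L_\xi$ has a unique stationary measure $\mu_\xi$ (and the integral is finite). Noise Induced Order: there exist $0<\xi'<\xi''$ such that for all $\xi\ge\xi'$ the system has a unique stationary measure $\mu_\xi$, with density $f_\xi$, and the Lyapunov exponent $\lambda(\xi)=\int\ln(|T'|)\,d\mu_\xi$ transitions continuously (as a function of $\xi$) from positive to negative, i.e. $\lambda(\xi')>0$ and $\lambda(\xi'')<0$. *)

(* Defs.v *)
From HB Require Import structures.
From mathcomp Require Import all_boot all_order all_algebra.
From mathcomp Require Import all_classical all_reals all_analysis.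
From mathcomp Require Import measurable_realfun.

Set Implicit Arguments.
Unset Strict Implicit.
Unset Printing Implicit Defensive.
Import Order.TTheory GRing.Theory Num.Theory.
Import numFieldNormedType.Exports.

Local Open Scope classical_set_scope.
Local Open Scope ring_scope.

(* The phase space [-1, 1] is a subset of the line.  A map of it is a function
   [T : R -> R] mapping it into itself, whose values elsewhere are irrelevant;
   functions on it are functions on R up to equality on it; a probability
   measure on it is a Borel probability measure on R giving it mass 1. *)
Definition phase (R : realType) : set R := `[-1, 1]%classic.
Arguments phase {R}.

Definition lineProb (R : realType) := probability (measurableTypeR R) R.

Definition same_measure (R : realType) (mu nu : set R -> \bar R) : Prop :=
  forall A : set R, measurable A -> mu A = nu A.

(* C^1 on the open intervals of a finite partition of [a, b]: neither
   continuity nor bounded one-sided derivatives are required at the partition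
   points. *)
Definition piecewise_C1 (R : realType) (a b : R) (T : R -> R) : Prop :=
  exists s : seq R, itv_partition a b s /\
    forall i, (i < size s)%N ->
    forall x, nth b (a :: s) i < x < nth b s i ->
      derivable T x 1 /\ {for x, continuous (derive1 T)}.

Definition nonsingular (R : realType) (T : R -> R) : Prop :=
  forall A : set R, measurable A -> A `<=` phase ->
    lebesgue_measure A = 0%E -> lebesgue_measure (phase `&` T @^-1` A) = 0%E.

Definition transfer (R : realType) (T : R -> R) (mu : set R -> \bar R) :
    set R -> \bar R :=
  fun A => mu (phase `&` T @^-1` A).

(* the signed measure f m on the phase space *)
Definition fun_measure (R : realType) (f : R -> R) : set R -> \bar R :=
  fun A => (\int[lebesgue_measure]_(x in phase `&` A) (f x)%:E)%E.

Definition is_density (R : realType) (nu : set R -> \bar R) (f : R -> R) :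
    Prop :=
  lebesgue_measure.-integrable phase (EFin \o f) /\
  forall A : set R, measurable A -> A `<=` phase -> nu A = fun_measure f A.

(* A chosen density: densities are unique up to null sets; the value is
   meaningless if there is none. *)
Definition density (R : realType) (nu : set R -> \bar R) : R -> R :=
  xget (fun=> 0) [set f | is_density nu f].

Definition perron_frobenius (R : realType) (T : R -> R) (f : R -> R) : R -> R :=
  density (transfer T (fun_measure f)).

Definition mother_noise_kernel (R : realType) (rho : R -> R) : Prop :=
  [/\ exists M : R, forall a b : R, a <= b ->
        (total_variation a b rho <= M%:E)%E,
      exists2 c : R, 0 < c & forall x, -1 <= x <= 1 -> c <= rho x,
      forall x, ~~ (-1 <= x <= 1) -> rho x = 0 &
      (\int[lebesgue_measure]_(x in `[(-1)%R, 1%R]) (rho x)%:E)%E = 1%E].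

Definition rescaled_kernel (R : realType) (rho : R -> R) (xi : R) : R -> R :=
  fun x => xi^-1 * rho (x / xi).

Inductive boundary := Periodic | Reflecting.

(* [Num.ceil] selects the representative of x mod 2 in ]-1, 1]; the infimum in
   the reflecting case is attained, hence is a minimum. *)
Definition boundary_map (R : realType) (bc : boundary) (x : R) : R :=
  match bc with
  | Periodic => x - 2 * (Num.ceil ((x - 1) / 2))%:~R
  | Reflecting => inf [set `|x + 1 - 4 * i%:~R| | i in [set: int]] - 1
  end.

Definition ext0_measure (R : realType) (mu : set R -> \bar R) :
    set R -> \bar R :=
  fun A => mu (phase `&` A).

(* [set x | A (x + y)] is the translate A - y *)
Definition conv_measure (R : realType) (rho : R -> R) (xi : R)
    (mu : set R -> \bar R) : set R -> \bar R :=
  fun A => (\int[lebesgue_measure]_(y in `[(- xi)%R, xi])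
     ((rescaled_kernel rho xi y)%:E * mu [set x | A (x + y)%R]))%E.

Definition conv_fun (R : realType) (rho : R -> R) (xi : R) (g : R -> R) :
    R -> R :=
  fun x => \int[lebesgue_measure]_(y in `[- xi, xi])
    (rescaled_kernel rho xi y * g (x - y)).

Definition boundary_measure (R : realType) (bc : boundary)
    (mu : set R -> \bar R) : set R -> \bar R :=
  pushforward mu (boundary_map bc).

Definition boundary_density (R : realType) (bc : boundary) (g : R -> R) :
    R -> R :=
  density (boundary_measure bc
    (fun A => \int[lebesgue_measure]_(x in A) (g x)%:E)%E).

Definition annealed_transfer (R : realType) (T rho : R -> R) (bc : boundary)
    (xi : R) (mu : set R -> \bar R) : set R -> \bar R :=
  if xi == 0 then transfer T mu
  else boundary_measure bc (conv_measure rho xi (ext0_measure (transfer T mu))).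

Definition annealed_pf (R : realType) (T rho : R -> R) (bc : boundary)
    (xi : R) (f : R -> R) : R -> R :=
  if xi == 0 then perron_frobenius T f
  else boundary_density bc (conv_fun rho xi (perron_frobenius T f \_ phase)).

Definition stationary (R : realType) (T rho : R -> R) (bc : boundary) (xi : R)
    (mu : lineProb R) : Prop :=
  mu phase = 1%E /\ same_measure (annealed_transfer T rho bc xi mu) mu.

Definition has_unique_stationary (R : realType) (T rho : R -> R)
    (bc : boundary) (xi : R) : Prop :=
  (exists mu : lineProb R, stationary T rho bc xi mu) /\
  forall mu nu : lineProb R,
    stationary T rho bc xi mu -> stationary T rho bc xi nu ->
    same_measure mu nu.

Definition ac_invariant (R : realType) (T : R -> R) (mu : lineProb R) : Prop :=
  [/\ mu phase = 1%E, mu `<< lebesgue_measure &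
      same_measure (transfer T mu) mu].

Definition in_Lp (R : realType) (p : R) (f : R -> \bar R) : Prop :=
  measurable_fun phase f /\
  (Lnorm lebesgue_measure p%:E (f \_ phase) < +oo)%E.

(* [lne] gives ln 0 its value -oo. *)
Definition log_deriv (R : realType) (T : R -> R) : R -> \bar R :=
  fun x => lne (`|derive1 T x|%:E).

Definition stationary_measure (R : realType) (T rho : R -> R) (bc : boundary)
    (mu0 : lineProb R) (xi : R) : lineProb R :=
  if xi == 0 then mu0
  else xget (dirac (0 : measurableTypeR R) : lineProb R)
         [set mu | stationary T rho bc xi mu].

Definition lyapunov (R : realType) (T rho : R -> R) (bc : boundary)
    (mu0 : lineProb R) (xi : R) : \bar R :=
  (\int[stationary_measure T rho bc mu0 xi]_(x in phase) log_deriv T x)%E.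

(* At xi = 0 the measure [mu0] is given, so only integrability is at stake. *)
Definition lyapunov_well_defined (R : realType) (T rho : R -> R)
    (bc : boundary) (mu0 : lineProb R) (xi : R) : Prop :=
  (xi != 0 -> has_unique_stationary T rho bc xi) /\
  (stationary_measure T rho bc mu0 xi).-integrable phase (log_deriv T).

(* The BV norm of an element of L^1([-1, 1]): the infimum, over the functions
   equal to f almost everywhere, of the L^1 norm plus the total variation; it
   is +oo outside of BV. *)
Definition bv_norm (R : realType) (f : R -> R) : \bar R :=
  ereal_inf [set (\int[lebesgue_measure]_(x in phase) `|g x|%:E
                  + total_variation (-1)%R 1%R g)%E
            | g in [set g : R -> R | ae_eq lebesgue_measure phase g f]].

Definition zero_average_BV (R : realType) : set (R -> R) :=
  [set f | [/\ lebesgue_measure.-integrable phase (EFin \o f),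
               (bv_norm f < +oo)%E &
               (\int[lebesgue_measure]_(x in phase) (f x)%:E)%E = 0%E]].

Definition zero_average_opnorm (R : realType) (Q : (R -> R) -> (R -> R)) :
    \bar R :=
  ereal_sup [set bv_norm (Q f)
            | f in [set f | @zero_average_BV R f /\ (bv_norm f <= 1)%E]].

Definition noise_induced_order (R : realType) (T rho : R -> R) (bc : boundary)
    (mu0 : lineProb R) : Prop :=
  exists xi' xi'' : R,
    [/\ 0 < xi' < xi'',
        forall xi, xi' <= xi ->
          lyapunov_well_defined T rho bc mu0 xi /\
          exists f, is_density (stationary_measure T rho bc mu0 xi) f,
        {within [set xi | xi' <= xi], continuous (lyapunov T rho bc mu0)},
        (0 < lyapunov T rho bc mu0 xi')%E &
        (lyapunov T rho bc mu0 xi'' < 0)%E].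

(* Main.v *)
Require Import Defs.
From HB Require Import structures.
From mathcomp Require Import all_boot all_order all_algebra.
From mathcomp Require Import all_classical all_reals all_analysis.
From mathcomp Require Import measurable_realfun.
From mathcomp Require Import lra zify finmap.
Set Implicit Arguments.
Unset Strict Implicit.
Unset Printing Implicit Defensive.
Import Order.TTheory GRing.Theory Num.Theory.
Import numFieldNormedType.Exports.
Local Open Scope classical_set_scope.
Local Open Scope ring_scope.

(* Let K_xi(x, .) be the law of pi(T x + xi * noise); the stationary measures are
   the probabilities invariant under K_xi.  Cutting the line into the cells on
   which pi is an isometry and using the bounded variation of rho gives
     K_xi(x, A) <= (1/2 + 2 V / xi) m(A),   V bounding the variation of rho.
   Probabilities dominated by a fixed multiple of a finite measure have setwise
   limits along ultrafilters, and integrals of integrable functions pass to such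
   limits.  Hence K_xi has an invariant probability (limit of Cesaro means), and
   where it is unique it depends continuously on xi, since K_xi does, by the L^1
   continuity of dilations of rho.  As xi grows, the bound applied to A and to
   its complement forces mu_xi to m / 2, so that lambda(xi) tends to a negative
   number.
   Uniqueness passes from an amplitude to every larger one: K_xi(x, .) is
   absolutely continuous with respect to K_xi'(x, .) when xi <= xi'.  If K_xi' had
   two invariant probabilities, the positive and negative parts of their
   difference would be singular K_xi'-invariant measures; Cesaro means of K_xi
   started from each remain absolutely continuous with respect to it, and would
   produce two singular K_xi-invariant probabilities. *)

(** * Setwise convergence of dominated measures *)

Section dominated_measures.
Context d (X : measurableType d) (R : realType).
Variable m : {finite_measure set X -> \bar R}.
Import HBSimple.

Definition dominated_by (M : R) (mu : set X -> \bar R) :=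
  forall A, measurable A -> (mu A <= M%:E * m A)%E.

Lemma dominated_integral_le (M : R) (mu : {measure set X -> \bar R})
    (f : X -> \bar R) : 0 <= M -> dominated_by M mu ->
  measurable_fun setT f -> (forall x, 0 <= f x)%E ->
  (\int[mu]_x f x <= M%:E * \int[m]_x f x)%E.
Proof.
move=> M0 Mmu mf f0.
rewrite -[M]/((NngNum M0)%:num) -ge0_integral_mscale//.
by apply: ge0_le_measure_integral => //= A mA; exact: Mmu.
Qed.

Lemma dominated_integrable (M : R) (mu : {measure set X -> \bar R})
    (f : X -> \bar R) : 0 <= M -> dominated_by M mu ->
  m.-integrable setT f -> mu.-integrable setT f.
Proof.
move=> M0 Mmu /integrableP[mf fi]; apply/integrableP; split => //.
apply: (@le_lt_trans _ _ (M%:E * \int[m]_x `|f x|)%E).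
  by apply: dominated_integral_le => //; exact: measurableT_comp.
by rewrite lte_mul_pinfty.
Qed.

Definition setwise_cvg (I : Type) (F : set_system I)
    (mu_ : I -> set X -> \bar R) (mu : set X -> \bar R) :=
  forall A, measurable A -> fine (mu_ i A) @[i --> F] --> fine (mu A).

Lemma integral_sfunE (mu : {finite_measure set X -> \bar R}) (g : {sfun X >-> R}) :
  (\int[mu]_x (g x)%:E = \sum_(y <- fset_set (range g)) y%:E * mu (g @^-1` [set y]))%E.
Proof.
have mpre y : measurable (g @^-1` [set y]) by exact: measurable_sfunP.
transitivity (\int[mu]_x (\sum_(y <- fset_set (range g)) (y * \1_(g @^-1` [set y]) x)%:E))%E.
  apply: eq_integral => x _; rewrite sumEFin; congr EFin.
  by rewrite fimfunE fsbig_finite.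
rewrite integral_sum//; last first.
  move=> y; under eq_fun do rewrite EFinM.
  by apply: integrableZl => //; exact: integrable_indic.
apply: eq_bigr => y _.
under eq_integral do rewrite EFinM.
rewrite integralZl//; last exact: integrable_indic.
by rewrite integral_indic// setIT.
Qed.

Lemma setwise_cvg_integral (I : Type) (F : set_system I) (M : R)
    (mu_ : I -> {finite_measure set X -> \bar R})
    (mu : {finite_measure set X -> \bar R}) (f : X -> \bar R) :
  Filter F -> 0 <= M -> (forall i, dominated_by M (mu_ i)) ->
  dominated_by M mu -> setwise_cvg F mu_ mu -> m.-integrable setT f ->
  fine (\int[mu_ i]_x f x)%E @[i --> F] --> fine (\int[mu]_x f x)%E.
Proof.
move=> FF M0 Mmu_ Mmu cvgmu intf.
have mf : measurable_fun setT f by exact: measurable_int intf.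
have [g_ [intg _ g0]] := approximation_sfun_integrable measurableT intf.
have key n (nu : {finite_measure set X -> \bar R}) : dominated_by M nu ->
    (`|\int[nu]_x f x - \int[nu]_x (g_ n x)%:E| <=
     M%:E * \int[m]_x `|f x - (g_ n x)%:E|)%E.
  move=> Mnu; rewrite -integralB//; [|exact: dominated_integrable M0 Mnu intf|
    exact: dominated_integrable M0 Mnu (intg n)].
  have mfg : measurable_fun setT (fun x => f x - (g_ n x)%:E)%E.
    by apply: emeasurable_funB => //; exact/measurable_EFinP.
  apply: le_trans (le_abse_integral _ _ _) _ => //.
  by apply: dominated_integral_le => //; exact: measurableT_comp mfg.
have gcvg n : fine (\int[mu_ i]_x (g_ n x)%:E)%E @[i --> F] -->
    fine (\int[mu]_x (g_ n x)%:E)%E.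
  have gE (nu : {finite_measure set X -> \bar R}) : fine (\int[nu]_x (g_ n x)%:E)%E =
      \sum_(y <- fset_set (range (g_ n))) y * fine (nu (g_ n @^-1` [set y])).
    rewrite integral_sfunE -sum_fine; last first.
      by move=> y _; rewrite fin_numM// fin_num_measure//; exact: measurable_sfunP.
    apply: eq_bigr => y _; rewrite fineM//.
    by rewrite fin_num_measure//; exact: measurable_sfunP.
  under eq_fun do rewrite gE.
  rewrite gE; apply: cvg_big => //; first exact: add_continuous.
  by move=> y _; apply: cvgMr; apply: cvgmu; exact: measurable_sfunP.
apply/cvgrPdist_lt => e e0.
have e4 : 0 < e / 4 / (M + 1) by rewrite !divr_gt0// ltr_wpDl.
have [n gn] : exists n, (\int[m]_x `|f x - (g_ n x)%:E| <= (e / 4 / (M + 1))%:E)%E.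
  have /fine_cvgP[fing /cvgrPdist_le/(_ _ e4) gle] := g0.
  near \oo => n; exists n.
  have fn : (\int[m]_x `|f x - (g_ n x)%:E|)%E \is a fin_num by near: n.
  rewrite -(fineK fn) lee_fin.
  have : `|0 - fine (\int[m]_x `|f x - (g_ n x)%:E|)%E| <= e / 4 / (M + 1) by near: n.
  by rewrite sub0r normrN; apply: le_trans; exact: ler_norm.
have {gn}key (nu : {finite_measure set X -> \bar R}) : dominated_by M nu ->
    `|fine (\int[nu]_x f x)%E - fine (\int[nu]_x (g_ n x)%:E)%E| <= e / 4.
  move=> Mnu.
  have f1 := integrable_fin_num measurableT (dominated_integrable M0 Mnu intf).
  have f2 := integrable_fin_num measurableT (dominated_integrable M0 Mnu (intg n)).
  have f12 : (\int[nu]_x f x - \int[nu]_x (g_ n x)%:E)%E \is a fin_num.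
    by rewrite fin_numB f1 f2.
  rewrite -lee_fin -fineB// -fine_abse// fineK ?abse_fin_num//.
  apply: le_trans (key n _ Mnu) _.
  apply: (@le_trans _ _ (M%:E * (e / 4 / (M + 1))%:E)%E).
    by rewrite lee_wpmul2l// lee_fin.
  rewrite -EFinM lee_fin mulrA ler_pdivrMr ?ltr_wpDl//.
  by rewrite [M * _]mulrC mulrDr mulr1 lerDl divr_ge0// ltW.
have /cvgrPdist_lt/(_ _ (divr_gt0 e0 (ltr0Sn R 3))) := gcvg n.
move=> Gi; apply: filterS Gi => i gi.
have := key _ (Mmu_ i); have := key _ Mmu.
set a := fine _; set b := fine _ in gi *; set c := fine _; set b' := fine _ in gi *.
rewrite !ler_norml => /andP[? ?] /andP[? ?].
move: gi; rewrite !ltr_norml => /andP[? ?].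
by apply/andP; split; lra.
Unshelve. all: end_near. Qed.

End dominated_measures.

Lemma ultra_cvg_in_compact (I : Type) (T : topologicalType) (U : set_system I)
    (f : I -> T) (K : set T) : UltraFilter U -> compact K -> U (f @^-1` K) ->
  exists2 p, K p & f i @[i --> U] --> p.
Proof.
move=> UU cK UK.
have [p [Kp clp]] := cK (fmap f U) _ UK.
exists p => // V /= Vp; have [//|UnV] := in_ultra_setVsetC (f @^-1` V) UU.
by have [x [nVx Vx]] := clp (~` V) V UnV Vp.
Qed.

Lemma probability_of_function d (X : measurableType d) (R : realType)
    (f : set X -> \bar R) :
  f set0 = 0%E -> (forall A, 0 <= f A)%E -> semi_sigma_additive f ->
  f setT = 1%E -> exists P : probability X R, forall A, P A = f A.
Proof.
move=> f0 fge0 fsigma f1.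
pose H1 := isMeasure.Build _ _ _ f f0 fge0 fsigma.
pose mf : {measure set X -> \bar R} := HB.pack f H1.
pose H2 := Measure_isProbability.Build _ _ _ mf f1.
pose P : probability X R := HB.pack (Measure.sort mf) H2.
by exists P.
Qed.

Lemma fine_measure_tail d (X : measurableType d) (R : realType)
    (nu : {finite_measure set X -> \bar R}) (F : (set X)^nat) n :
  (forall i, measurable (F i)) -> trivIset setT F ->
  fine (nu (\bigcup_i F i)) - \sum_(0 <= i < n) fine (nu (F i)) =
  fine (nu (\bigcup_i F i `\` \big[setU/set0]_(0 <= i < n) F i)).
Proof.
move=> mF tF; rewrite sum_fine; last by move=> i _; rewrite fin_num_measure.
rewrite !big_mkord -measure_bigsetU//.
have mU : measurable (\big[setU/set0]_(i < n) F i) by exact: bigsetU_measurable.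
rewrite measureD//; last 2 first.
- exact: bigcup_measurable.
- by rewrite ltey_eq fin_num_measure//; exact: bigcup_measurable.
rewrite fineB ?fin_num_measure//; last 2 first.
- exact: bigcup_measurable.
- by apply: measurableI => //; exact: bigcup_measurable.
congr (_ - fine (nu _)).
by apply/esym/setIidr; exact: bigsetU_bigcup.
Qed.

Lemma ultra_setwise_limit d (X : measurableType d) (R : realType)
    (m : {finite_measure set X -> \bar R}) (I : Type) (U : set_system I) (M : R)
    (mu_ : I -> probability X R) : UltraFilter U -> 0 <= M ->
  (forall i, dominated_by m M (mu_ i)) ->
  exists mu : probability X R, dominated_by m M mu /\ setwise_cvg U mu_ mu.
Proof.
move=> UU M0 Mmu_; have PU : ProperFilter U := @ultra_proper _ _ UU.
have le_lim (u v : I -> R) (a b : R) : u i @[i --> U] --> a -> v i @[i --> U] --> b ->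
    (forall i, u i <= v i) -> a <= b.
  move=> ua vb uv; rewrite -subr_ge0.
  apply: (@closed_cvg _ R U PU (v \- u) (fun x => 0 <= x)).
  - exact: closed_ge.
  - by apply: filterE => i /=; rewrite subr_ge0.
  - exact: cvgB.
have fmu i A : measurable A -> 0 <= fine (mu_ i A) <= 1.
  move=> mA; rewrite fine_ge0//= -lee_fin fineK ?fin_num_measure//.
  exact: probability_le1.
have [L HL] : exists L : set X -> R, forall A, 0 <= L A /\
    (measurable A -> fine (mu_ i A) @[i --> U] --> L A).
  suff /choice : forall A, exists l : R, 0 <= l /\
    (measurable A -> fine (mu_ i A) @[i --> U] --> l) by move=> [L LP]; exists L.
  move=> A; have [mA|nmA] := pselect (measurable A); last by exists 0.
  have [|l + cl] := @ultra_cvg_in_compact I R U (fun i => fine (mu_ i A))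
    `[0, 1]%classic UU (@segment_compact R 0 1).
    by apply: filterE => i /=; rewrite in_itv/=; exact: fmu.
  by rewrite /= in_itv/= => /andP[l0 _]; exists l.
have L0 A : 0 <= L A by case: (HL A).
have cvgL A : measurable A -> fine (mu_ i A) @[i --> U] --> L A by case: (HL A).
have LM A : measurable A -> L A <= M * fine (m A).
  move=> mA; apply: le_lim (cvgL _ mA) (cvg_cst _) _ => i.
  rewrite -lee_fin EFinM !fineK ?fin_num_measure//.
  exact: Mmu_.
have Lcst A c : measurable A -> (forall i, mu_ i A = c%:E) -> L A = c.
  move=> mA h; have := cvgL _ mA.
  under eq_fun do rewrite h /=.
  by move=> /cvg_lim <-//; exact: lim_cst.
have Lsigma : semi_sigma_additive (EFin \o L).
  move=> F mF tF mUF.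
  have -> : (fun n => \sum_(0 <= i < n) (EFin \o L) (F i))%E =
      EFin \o (fun n => \sum_(0 <= i < n) L (F i)).
    by apply/funext => n /=; rewrite sumEFin.
  apply: cvg_EFin; first exact: nearW.
  have mtail : M * (fine (m (\bigcup_i F i)) - \sum_(0 <= i < n) fine (m (F i)))
      @[n --> \oo] --> (0 : R).
    rewrite -[X in _ --> X](mulr0 M); apply: cvgMr.
    rewrite -[X in _ --> X](subrr (fine (m (\bigcup_i F i)))).
    apply: cvgB; first exact: cvg_cst.
    have mFcvg : (\sum_(0 <= i < n) m (F i))%E @[n --> \oo] -->
        (fine (m (\bigcup_i F i)))%:E.
      by rewrite fineK ?fin_num_measure//; exact: measure_semi_sigma_additive.
    have /fine_cvgP[_] := mFcvg.
    apply: cvg_trans; apply: near_eq_cvg; near=> n.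
    by rewrite /= -sum_fine// => i _; rewrite fin_num_measure.
  apply/cvgrPdist_le => e e0.
  have /cvgrPdist_le/(_ e e0) := mtail.
  move=> Gn; apply: filterS Gn => n.
  rewrite sub0r normrN => Gn.
  have mB : measurable (\bigcup_i F i `\` \big[setU/set0]_(0 <= i < n) F i).
    by apply: measurableD => //; exact: bigsetU_measurable.
  have cvgD : fine (mu_ i (\bigcup_i F i)) - \sum_(0 <= j < n) fine (mu_ i (F j))
      @[i --> U] --> L (\bigcup_i F i) - \sum_(0 <= j < n) L (F j).
    apply: cvgB; first exact: cvgL.
    by apply: cvg_big => //; [exact: add_continuous|move=> j _; exact: cvgL].
  have D0 : 0 <= L (\bigcup_i F i) - \sum_(0 <= j < n) L (F j).
    apply: le_lim (cvg_cst _) cvgD _ => i.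
    by rewrite fine_measure_tail// fine_ge0.
  have DM : L (\bigcup_i F i) - \sum_(0 <= j < n) L (F j) <=
      M * (fine (m (\bigcup_i F i)) - \sum_(0 <= i < n) fine (m (F i))).
    apply: le_lim cvgD (cvg_cst _) _ => i; rewrite !fine_measure_tail// -lee_fin EFinM.
    by rewrite !fineK ?fin_num_measure//; exact: Mmu_.
  by rewrite ger0_norm// (le_trans DM)// (le_trans _ Gn)// ler_norm.
have E0 : (EFin \o L) set0 = 0%E by rewrite /= (Lcst _ 0)// => i; rewrite measure0.
have E1 : (EFin \o L) setT = 1%E.
  by rewrite /= (Lcst _ 1)// => i; rewrite probability_setT.
have Ege0 A : (0 <= (EFin \o L) A)%E by rewrite /= lee_fin.
have [mu muE] := probability_of_function E0 Ege0 Lsigma E1.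
exists mu; split.
  move=> A mA; rewrite muE /= -(fineK (fin_num_measure m A mA)) -EFinM lee_fin.
  exact: LM.
by move=> A mA; rewrite muE/=; exact: cvgL.
Unshelve. all: end_near. Qed.

(** * Markov kernels and their invariant probabilities *)

Lemma integral_probability_cst d (X : measurableType d) (R : realType)
    (mu : probability X R) (c : \bar R) : (\int[mu]_x cst c x = c)%E.
Proof.
rewrite integral_cst//; transitivity (c * 1)%E; last by rewrite mule1.
by congr (_ * _)%E; exact: probability_setT.
Qed.

Section markov_step.
Context d (X : measurableType d) (R : realType) (k : R.-pker X ~> X).
Local Open Scope ereal_scope.

Definition markov_step (mu : set X -> \bar R) (A : set X) : \bar R :=
  \int[mu]_x k x A.

Variable mu : probability X R.

Let markov_step0 : markov_step mu set0 = 0.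
Proof.
by rewrite /markov_step (eq_integral (cst 0)) ?integral0// => x _; rewrite measure0.
Qed.

Let markov_step_ge0 A : 0 <= markov_step mu A.
Proof. by apply: integral_ge0 => x _; exact: measure_ge0. Qed.

Let markov_step_sigma_additive : semi_sigma_additive (markov_step mu).
Proof.
move=> F mF tF mUF; rewrite [X in _ --> X](_ : _ =
  \int[mu]_x (\sum_(n <oo) k x (F n))); last first.
  apply: eq_integral => x _.
  by apply/esym/cvg_lim => //; exact/measure_semi_sigma_additive.
apply/cvg_closeP; split.
  by apply: is_cvg_nneseries => n _ _; exact: integral_ge0.
by rewrite closeE// integral_nneseries// => n; exact: measurable_kernel.
Qed.

HB.instance Definition _ := isMeasure.Build _ _ _
  (markov_step mu) markov_step0 markov_step_ge0 markov_step_sigma_additive.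

Let markov_step_setT : markov_step mu setT = 1.
Proof.
rewrite /markov_step; under eq_integral do rewrite prob_kernel.
exact: integral_probability_cst.
Qed.

HB.instance Definition _ :=
  Measure_isProbability.Build _ _ _ (markov_step mu) markov_step_setT.

End markov_step.

Section invariant_measures.
Context d (X : measurableType d) (R : realType).
Variable m : {finite_measure set X -> \bar R}.
Implicit Types (k : R.-pker X ~> X) (mu nu : probability X R).

Definition invariant k (mu : set X -> \bar R) :=
  forall A, measurable A -> markov_step k mu A = mu A.

Lemma pker_le1 k x A : measurable A -> (k x A <= 1)%E.
Proof.
move=> mA; rewrite -(@prob_kernel _ _ _ _ _ k x).
by apply: le_measure => //; exact/mem_set.
Qed.

Lemma integrable_pker k (nu : {finite_measure set X -> \bar R}) A : measurable A ->
  nu.-integrable setT (fun x => k x A).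
Proof.
move=> mA; have i1 := finite_measure_integrable_cst nu 1 (@measurableT _ X).
apply: (le_integrable measurableT _ _ i1); first exact: measurable_kernel.
by move=> x _; rewrite gee0_abs//= normr1 pker_le1.
Qed.

Lemma dominated_markov_step k M mu : 0 <= M ->
  (forall x, dominated_by m M (k x)) -> dominated_by m M (markov_step k mu).
Proof.
move=> M0 kM A mA; apply: (@le_trans _ _ (\int[mu]_x (cst (M%:E * m A)%E x))%E).
  apply: ge0_le_integral => //.
  - exact: measurable_kernel.
  - by move=> x _; exact: kM.
by rewrite integral_probability_cst.
Qed.

Lemma invariant_setwise_limit (I : Type) (F : set_system I) k M
    (mu_ : I -> probability X R) mu : ProperFilter F -> 0 <= M ->
  (forall i, dominated_by m M (mu_ i)) -> dominated_by m M mu ->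
  setwise_cvg F mu_ mu ->
  (forall A, measurable A ->
    fine (markov_step k (mu_ i) A) - fine (mu_ i A) @[i --> F] --> 0) ->
  invariant k mu.
Proof.
move=> FF M0 Mmu_ Mmu cvgmu almost A mA.
have stepcvg := setwise_cvg_integral (@filter_filter _ _ FF) M0 Mmu_ Mmu cvgmu
  (integrable_pker k m mA).
rewrite -[LHS]fineK ?fin_num_measure// -[RHS]fineK ?fin_num_measure//.
congr EFin.
have cvgA : fine (mu_ i A) @[i --> F] --> fine (markov_step k mu A).
  rewrite -[X in _ --> X]subr0; apply: cvg_trans (cvgB stepcvg (almost _ mA)).
  apply: near_eq_cvg; apply: filterE => i /=.
  by rewrite /markov_step opprB addrC subrK.
by move/cvg_lim : (cvgmu _ mA) => <-//; move/cvg_lim : cvgA => <-.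
Qed.

End invariant_measures.

Section cesaro.
Context d (X : measurableType d) (R : realType) (k : R.-pker X ~> X).
Variable nu : probability X R.

Definition markov_iter n : probability X R :=
  iter n (fun mu : probability X R => (markov_step k mu : probability X R)) nu.

Definition cesaro n : set X -> \bar R :=
  mscale (n.+1%:R^-1)%:nng (msum (fun j => markov_iter j.+1) n.+1).

HB.instance Definition _ n := Measure.on (cesaro n).

Lemma cesaroE n A :
  cesaro n A = (n.+1%:R^-1%:E * \sum_(j < n.+1) markov_iter j.+1 A)%E.
Proof. by []. Qed.

Let cesaro_setT n : cesaro n setT = 1%E.
Proof.
rewrite cesaroE; under eq_bigr do rewrite probability_setT.
by rewrite sumEFin -EFinM big_const_ord iter_addr_0 mulVf.
Qed.

HB.instance Definition _ n :=
  Measure_isProbability.Build _ _ _ (cesaro n) (cesaro_setT n).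

Lemma markov_step_cesaro n A : measurable A ->
  markov_step k (cesaro n) A =
  (n.+1%:R^-1%:E * \sum_(j < n.+1) markov_iter j.+2 A)%E.
Proof.
move=> mA; rewrite /markov_step /cesaro.
rewrite ge0_integral_mscale//=; last exact: measurable_kernel.
rewrite ge0_integral_measure_sum//; exact: measurable_kernel.
Qed.

Lemma cesaro_almost_invariant A : measurable A ->
  fine (markov_step k (cesaro n) A) - fine (cesaro n A) @[n --> \oo] --> 0.
Proof.
move=> mA.
have fm j : markov_iter j A \is a fin_num by exact: fin_num_measure.
have p01 j : 0 <= fine (markov_iter j A) <= 1.
  by rewrite fine_ge0//= -lee_fin fineK//; exact: probability_le1.
have E n : fine (markov_step k (cesaro n) A) - fine (cesaro n A) =
    n.+1%:R^-1 * (fine (markov_iter n.+2 A) - fine (markov_iter 1 A)).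
  rewrite markov_step_cesaro// cesaroE.
  have fs (u : nat -> nat) : (\sum_(j < n.+1) markov_iter (u j) A)%E \is a fin_num.
    by apply/sum_fin_numP => j _ _; exact: fm.
  rewrite !fineM//; last exact: (fs (fun j => j.+2)).
  rewrite -mulrBr -!sum_fine//; congr (_ * _).
  rewrite -sumrB.
  rewrite -(big_mkord xpredT (fun j => fine (markov_iter j.+2 A) - fine (markov_iter j.+1 A))).
  by rewrite (telescope_sumr (fun j => fine (markov_iter j.+1 A))).
under eq_fun do rewrite E.
apply/cvgrPdist_le => e e0.
have /cvgrPdist_le/(_ e e0) := @cvg_harmonic R.
move=> h; apply: filterS h => n; rewrite !sub0r !normrN => h.
apply: le_trans h; rewrite normrM ler_piMr//.
have /andP[? ?] := p01 n.+2; have /andP[? ?] := p01 1%N.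
by rewrite ler_norml; apply/andP; split; lra.
Qed.

End cesaro.

Section krylov_bogoliubov.
Context d (X : measurableType d) (R : realType).
Variable m : {finite_measure set X -> \bar R}.

Lemma invariant_exists (k : R.-pker X ~> X) M (nu : probability X R) : 0 <= M ->
  (forall x, dominated_by m M (k x)) ->
  exists mu : probability X R, invariant k mu /\
    forall N, measurable N -> (forall n, markov_iter k nu n N = 0%E) ->
      mu N = 0%E.
Proof.
move=> M0 kM.
have [U [UU ooU]] := @ultraFilterLemma nat \oo _.
have cM n : dominated_by m M (cesaro k nu n).
  move=> A mA; rewrite cesaroE.
  apply: (@le_trans _ _ (n.+1%:R^-1%:E * \sum_(j < n.+1) (M%:E * m A)))%E.
    rewrite lee_wpmul2l// ?lee_fin//; apply: lee_sum => j _.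
    exact: (dominated_markov_step (markov_iter k nu j) M0 kM).
  rewrite -(fineK (fin_num_measure m _ mA)) -EFinM sumEFin -EFinM lee_fin.
  by rewrite big_const_ord iter_addr_0 -[X in _ * X]mulr_natl mulKf.
have [mu [Mmu cvgmu]] := ultra_setwise_limit UU M0 cM.
exists mu; split.
  apply: (invariant_setwise_limit _ M0 cM Mmu cvgmu) => A mA.
  by apply: cvg_trans (cesaro_almost_invariant k nu mA); exact: cvg_app.
move=> N mN N0.
have c0 n : cesaro k nu n N = 0%E.
  by rewrite cesaroE big1 ?mule0// => j _; exact: N0.
have := cvgmu _ mN; rewrite (_ : (fun i => _) = cst (0 : R)); last first.
  by apply/funext => n; rewrite [X in fine X]c0.
move=> /cvg_lim h; rewrite -(fineK (fin_num_measure mu _ mN)) -h//.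
by congr EFin; exact: lim_cst.
Qed.

End krylov_bogoliubov.

Section invariant_unique.
Context d (X : measurableType d) (R : realType).
Variable m : {finite_measure set X -> \bar R}.
Implicit Types (k : R.-pker X ~> X) (mu nu pi : probability X R).
Implicit Types alpha beta : {finite_measure set X -> \bar R}.

Definition unique_invariant k := forall mu nu,
  invariant k mu -> invariant k nu -> forall A, measurable A -> mu A = nu A.

Lemma markov_step_fin_num k alpha A : measurable A ->
  markov_step k alpha A \is a fin_num.
Proof. by move=> mA; exact: integrable_fin_num (integrable_pker k alpha mA). Qed.

Lemma markov_step_ge0 k alpha A : (0 <= markov_step k alpha A)%E.
Proof. exact: integral_ge0. Qed.

Lemma markov_step_add k alpha A B : measurable A -> measurable B ->
  A `&` B = set0 ->
  (markov_step k alpha (A `|` B) = markov_step k alpha A + markov_step k alpha B)%E.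
Proof.
move=> mA mB AB; rewrite /markov_step -ge0_integralD//; last 2 first.
- exact: measurable_kernel.
- exact: measurable_kernel.
by apply: eq_integral => x _; rewrite measureU.
Qed.

Lemma markov_step_total k alpha : markov_step k alpha setT = alpha setT.
Proof.
rewrite /markov_step; under eq_integral do rewrite prob_kernel.
by rewrite integral_cst// mul1e.
Qed.

Lemma markov_step_measure_add k alpha beta A : measurable A ->
  (markov_step k (measure_add alpha beta) A =
   markov_step k alpha A + markov_step k beta A)%E.
Proof.
by move=> mA; rewrite /markov_step ge0_integral_measure_add//; exact: measurable_kernel.
Qed.

(* [alpha] is the positive part of the invariant signed measure [mu - nu]:
   mass conservation forces it to be invariant as well, so its null sets are
   preserved. *)
Lemma invariant_difference_null k mu nu alpha beta P :
  measurable P -> alpha (~` P) = 0%E -> beta P = 0%E ->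
  (forall A, measurable A -> mu A + beta A = nu A + alpha A)%E ->
  invariant k mu -> invariant k nu ->
  forall A, measurable A -> alpha A = 0%E -> markov_step k alpha A = 0%E.
Proof.
move=> mP aN bP mubnua imu inu.
have stepE A : measurable A ->
    (mu A + markov_step k beta A = nu A + markov_step k alpha A)%E.
  move=> mA; rewrite -[X in (X + _)%E]imu// -[X in (X + _ = _)%E]/(markov_step k mu A).
  rewrite -[X in (_ = X + _)%E]inu// -!markov_step_measure_add//.
  apply: eq_measure_integral => B mB _.
  rewrite -[LHS]/(measure_add _ _ _) -[RHS]/(measure_add _ _ _) !measure_addE.
  exact: mubnua.
have mN := measurableC mP.
have EFinE (x : \bar R) : x \is a fin_num -> exists r : R, x = r%:E.
  by move=> /fineK <-; eexists.
have [aP eaP] := EFinE _ (fin_num_measure alpha _ mP).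
have [nP enP] := EFinE _ (fin_num_measure nu _ mP).
have [kaP ekaP] := EFinE _ (markov_step_fin_num k alpha mP).
have [kaN ekaN] := EFinE _ (markov_step_fin_num k alpha mN).
have [kbP ekbP] := EFinE _ (markov_step_fin_num k beta mP).
have totalE : (markov_step k alpha P + markov_step k alpha (~` P) = alpha P)%E.
  rewrite -markov_step_add ?setICr// setUCr markov_step_total.
  by rewrite -(setUCr P) measureU ?setICr// [X in (_ + X)%E]aN adde0.
have b0 := markov_step_ge0 k beta P.
have a0 := markov_step_ge0 k alpha (~` P).
have h1 := stepE _ mP; have h2 := mubnua _ mP.
rewrite bP adde0 in h2; move: h1 totalE b0 a0.
rewrite h2 eaP enP ekaP ekaN ekbP -!EFinD !lee_fin => -[h1] [h3] b0 a0.
have kaN0 : markov_step k alpha (~` P) = 0%E by rewrite ekaN; congr EFin; lra.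
have kbP0 : markov_step k beta P = 0%E by rewrite ekbP; congr EFin; lra.
move=> A mA aA.
have mAP : measurable (A `&` P) by exact: measurableI.
have mAN : measurable (A `&` ~` P) by exact: measurableI.
have le0 (gamma : {finite_measure set X -> \bar R}) B C : measurable B ->
    measurable C -> B `<=` C -> markov_step k gamma C = 0%E ->
    markov_step k gamma B = 0%E.
  move=> mB mC BC g0; apply/eqP; rewrite eq_le markov_step_ge0 andbT -g0.
  apply: ge0_le_integral => //; [exact: measurable_kernel..|move=> x _].
  by apply: le_measure => //; exact/mem_set.
have aAP : alpha (A `&` P) = 0%E by apply: subset_measure0 aA => //; exact: subIsetl.
have kbAP : markov_step k beta (A `&` P) = 0%E by apply: le0 kbP0.
have bAP : beta (A `&` P) = 0%E by apply: subset_measure0 bP => //; exact: subIsetr.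
have kaAN : markov_step k alpha (A `&` ~` P) = 0%E by apply: le0 kaN0.
rewrite -(setIT A) -(setUCr P) setIUr markov_step_add//; last first.
  by rewrite setIACA setICr setI0.
rewrite kaAN adde0.
have := stepE _ mAP; have := mubnua _ mAP; rewrite kbAP aAP bAP !adde0 => ->.
have [r ->] := EFinE _ (fin_num_measure nu _ mAP).
have [s ->] := EFinE _ (markov_step_fin_num k alpha mAP).
by rewrite -EFinD => -[rs]; congr EFin; lra.
Qed.

Lemma invariant_null_exists k1 k2 M alpha nu : 0 <= M ->
  (forall x, dominated_by m M (k2 x)) ->
  (forall x A, measurable A -> k1 x A = 0%E -> k2 x A = 0%E) ->
  (forall A, measurable A -> alpha A = 0%E -> markov_step k1 alpha A = 0%E) ->
  alpha setT != 0%E ->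
  exists pi, invariant k2 pi /\
    forall N, measurable N -> alpha N = 0%E -> pi N = 0%E.
Proof.
move=> M0 k2M k12 k1null a0.
have ntop : alpha setT != +oo%E by rewrite -ltey ltey_eq fin_num_measure.
have [pi [ipi pi0]] := invariant_exists (mnormalize alpha nu) M0 k2M.
exists pi; split => // N mN aN; apply: pi0 => // n.
elim: n N mN aN => [|n IH] N mN aN.
  by rewrite /= /mnormalize (negbTE a0) (negbTE ntop) /= aN mul0e.
pose B := [set x | k1 x N != 0%E].
have mB : measurable B.
  rewrite (_ : B = setT `&` (fun x => k1 x N) @^-1` [set~ 0%E]); last first.
    by rewrite setTI; apply/seteqP; split => x /eqP.
  apply: (measurable_kernel k1 N mN measurableT).
  exact/measurableC/emeasurable_set1.
have aB : alpha B = 0%E.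
  apply: measure_negligible => //.
  have [Z [mZ Z0 ZB]] : ae_eq alpha setT (fun x => k1 x N) (cst 0%E).
    apply/ae_eq_integral_abs => //; first exact: measurable_kernel.
    rewrite -[RHS](k1null _ mN aN); apply: eq_integral => x _.
    by rewrite gee0_abs.
  exists Z; split => //; apply: subset_trans ZB => x /= /eqP Bx h.
  by apply: Bx; exact: h.
have nB := IH _ mB aB.
apply/eqP; rewrite eq_le; apply/andP; split; last exact: measure_ge0.
rewrite -nB -[B in leRHS]setIT -integral_indic//.
apply: ge0_le_integral => //.
- exact: measurable_kernel.
- exact/measurable_EFinP.
move=> x _; rewrite indicE; have [Bx|Bx] := boolP (x \in B).
  exact: pker_le1.
rewrite k12//; apply/eqP; apply: contraNT Bx => Bx; exact/mem_set.
Qed.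

Lemma unique_invariant_transfer k1 k2 M : 0 <= M ->
  (forall x, dominated_by m M (k2 x)) ->
  (forall x A, measurable A -> k1 x A = 0%E -> k2 x A = 0%E) ->
  unique_invariant k2 -> unique_invariant k1.
Proof.
move=> M0 k2M k12 uniq2 mu nu imu inu.
pose sigma : {charge set X -> \bar R} := cadd (charge_of_finite_measure mu)
  (cscale (-1) (charge_of_finite_measure nu)).
have [P [N PN]] := Hahn_decomposition sigma.
have [[mP _] [mN _] PUN PIN] := PN.
have NE : N = ~` P.
  rewrite -[~` P]setTI -PUN setIUl setICr set0U.
  by apply/esym/setIidl/subsets_disjoint; rewrite setCK setIC.
pose alpha : {finite_measure set X -> \bar R} := jordan_pos PN.
pose beta : {finite_measure set X -> \bar R} := jordan_neg PN.
have EFinE (x : \bar R) : x \is a fin_num -> exists r : R, x = r%:E.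
  by move=> /fineK <-; eexists.
have decomp A : measurable A -> (mu A + beta A = nu A + alpha A)%E.
  move=> mA; have h : (mu A - nu A = alpha A - beta A)%E.
    transitivity (sigma A); first by rewrite -[nu A]mul1e -mulNe; exact: erefl.
    rewrite -[beta A]mul1e -mulNe; exact: jordan_decomp.
  move: h.
  have [a ->] := EFinE _ (fin_num_measure alpha _ mA).
  have [b ->] := EFinE _ (fin_num_measure beta _ mA).
  have [u ->] := EFinE _ (fin_num_measure mu _ mA).
  have [v ->] := EFinE _ (fin_num_measure nu _ mA).
  by rewrite -!EFinN -!EFinD => -[h]; congr EFin; lra.
have aN : alpha (~` P) = 0%E.
  rewrite -[LHS]/(jordan_pos PN (~` P)) jordan_posE cjordan_posE /crestr0.
  by rewrite mem_set ?/crestr ?setICl ?charge0//; exact: measurableC.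
have bP : beta P = 0%E.
  rewrite -[LHS]/(jordan_neg PN P) jordan_negE cjordan_negE /crestr0 mem_set//.
  by rewrite /crestr PIN charge0 oppe0.
have decomp' A : measurable A -> (nu A + alpha A = mu A + beta A)%E.
  by move=> mA; rewrite decomp.
have a_null := invariant_difference_null mP aN bP decomp imu inu.
have b_null : forall A, measurable A -> beta A = 0%E -> markov_step k1 beta A = 0%E.
  apply: (invariant_difference_null (measurableC mP) _ aN decomp' inu imu).
  by rewrite setCK.
have ab1 : alpha setT = beta setT.
  have := decomp _ measurableT; rewrite !probability_setT.
  have [a ->] := EFinE _ (fin_num_measure alpha _ measurableT).
  have [b ->] := EFinE _ (fin_num_measure beta _ measurableT).
  by rewrite -!EFinD => -[h]; congr EFin; lra.
have [a0|a0] := eqVneq (alpha setT) 0%E.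
  move=> A mA; have := decomp _ mA.
  have -> : alpha A = 0%E by apply: subset_measure0 a0.
  have -> : beta A = 0%E by rewrite ab1 in a0; apply: subset_measure0 a0.
  by rewrite !adde0.
have [pi1 [ipi1 pi1N]] := invariant_null_exists mu M0 k2M k12 a_null a0.
have b0 : beta setT != 0%E by rewrite -ab1.
have [pi2 [ipi2 pi2P]] := invariant_null_exists mu M0 k2M k12 b_null b0.
have pi1P : pi1 P = 0%E by rewrite (uniq2 _ _ ipi1 ipi2)// pi2P.
have : pi1 setT = 0%E.
  rewrite -(setUCr P) measureU ?setICr//; last exact: measurableC.
  by rewrite [X in (X + _)%E]pi1P [X in (_ + X)%E]pi1N ?adde0//; exact: measurableC.
by rewrite probability_setT => /eqP; rewrite onee_eq0.
Qed.

End invariant_unique.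

Lemma invariant_setwise_continuous d (X : measurableType d) (R : realType)
    (m : {finite_measure set X -> \bar R}) (k_ : nat -> R.-pker X ~> X)
    (k : R.-pker X ~> X) (M : R) (mu_ : nat -> probability X R)
    (mu : probability X R) : 0 <= M ->
  (forall n, dominated_by m M (mu_ n)) ->
  (forall n, invariant (k_ n) (mu_ n)) ->
  invariant k mu -> unique_invariant k ->
  (forall A e, measurable A -> 0 < e -> \forall n \near \oo,
    forall x, `|fine (k x A) - fine (k_ n x A)| <= e) ->
  setwise_cvg \oo mu_ mu.
Proof.
move=> M0 Mmu_ imu_ imu uniq unif A mA; apply: contrapT => ncvg.
have [e [e0 nnear]] : exists e, 0 < e /\
    ~ \forall n \near \oo, `|fine (mu A) - fine (mu_ n A)| < e.
  apply: contrapT => h; apply: ncvg; apply/cvgrPdist_lt => e e0.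
  by apply: contrapT => h'; apply: h; exists e.
pose B := [set n | e <= `|fine (mu A) - fine (mu_ n A)|].
have PG : ProperFilter (within B \oo).
  apply: Build_ProperFilter_ex => P GP; apply: contrapT => P0; apply: nnear.
  have GP' : \forall n \near \oo, B n -> P n by exact: GP.
  apply: filterS GP' => n BP; rewrite ltNge; apply/negP => /BP Pn.
  by apply: P0; exists n.
have [U [UU GU]] := ultraFilterLemma PG.
have PU : ProperFilter U := @ultra_proper _ _ UU.
have ooU : \oo `<=` U.
  by move=> P ooP; apply: GU; apply: filterS ooP => n Pn _.
have UB : U B.
  by apply: GU; rewrite /within /=; near=> n.
have [mu' [Mmu' cvgmu']] := ultra_setwise_limit UU M0 Mmu_.
have imu' : invariant k mu'.
  apply: (invariant_setwise_limit PU M0 Mmu_ Mmu' cvgmu') => C mC.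
  have : fine (markov_step k (mu_ n) C) - fine (mu_ n C) @[n --> \oo] --> 0.
    apply/cvgrPdist_le => e' e'0; near=> n.
    rewrite sub0r normrN -imu_//.
    have f1 := markov_step_fin_num k (mu_ n) mC.
    have f2 := markov_step_fin_num (k_ n) (mu_ n) mC.
    rewrite -fineB// /markov_step -integralB//; [|exact: integrable_pker..].
    rewrite -lee_fin -fine_abse; last first.
      rewrite integralB//; [|exact: integrable_pker..].
      by rewrite fin_numB [X in X && _]f1 [X in _ && X]f2.
    rewrite fineK; last first.
      rewrite abse_fin_num integralB//; [|exact: integrable_pker..].
      by rewrite fin_numB [X in X && _]f1 [X in _ && X]f2.
    have mD : measurable_fun setT (fun x => k x C - k_ n x C)%E.
      by apply: emeasurable_funB; exact: measurable_kernel.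
    apply: le_trans (le_abse_integral _ _ _) _ => //.
    rewrite -[leRHS](integral_probability_cst (mu_ n)).
    apply: ge0_le_integral => //.
    - exact: measurableT_comp mD.
    - have knC (k' : R.-pker X ~> X) x : k' x C \is a fin_num.
        rewrite ge0_fin_numE//; exact: le_lt_trans (pker_le1 _ _ mC) (ltry _).
      move=> x _.
      rewrite -(fineK (knC k x)) -(fineK (knC (k_ n) x)) -EFinB /= lee_fin.
      by move: x; near: n; exact: unif.
  by apply: cvg_trans; exact: cvg_app.
have muA : fine (mu' A) = fine (mu A) by rewrite (uniq mu' mu imu' imu).
have := cvgmu' A mA; rewrite muA => /cvgrPdist_lt/(_ e e0) Ue.
have [n [Bn Un]] := filter_ex (filterI UB Ue).
by move: Un; rewrite ltNge; move: Bn; rewrite /B /= => ->.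
Unshelve. all: end_near. Qed.

(** * The boundary map and affine changes of variables *)

Lemma inf_minimum (R : realType) (E : set R) (v : R) : E v -> lbound E v -> inf E = v.
Proof.
move=> Ev lbv; apply/eqP; rewrite eq_le; apply/andP; split.
  by apply: ge_inf => //; exists v.
by apply: lb_le_inf lbv; exact: (ex_intro E v Ev).
Qed.

Lemma boundary_map_cell (R : realType) (bc : boundary) (j : int) :
  exists2 s : R, s = 1 \/ s = -1 & forall w, 2 * j%:~R - 1 < w <= 2 * j%:~R + 1 ->
    boundary_map bc w = s * (w - 2 * j%:~R).
Proof.
case: bc => /=.
  exists 1; first by left.
  move=> w /andP[w1 w2]; rewrite mul1r; congr (_ - 2 * _%:~R).
  apply: ceil_def; rewrite intrD mulrN1z.
  by apply/andP; split; lra.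
have int_cases (i i' : int) : (i'%:~R <= i%:~R :> R) \/ (i%:~R + 1 <= i'%:~R :> R).
  have [h|h] := leP i' i; [left|right]; first by rewrite ler_int.
  by rewrite -[1]/(1%:~R) -intrD ler_int; lia.
pose i := (j %/ 2)%Z.
have jE : j%:~R = 2 * i%:~R + (j %% 2)%Z%:~R :> R.
  by rewrite {1}(divz_eq j 2) intrD intrM mulrC.
have : (j %% 2)%Z = 0 \/ (j %% 2)%Z = 1 by lia.
move=> [j2|j2].
  exists 1; first by left.
  rewrite jE j2 addr0 => w /andP[w1 w2].
  rewrite (@inf_minimum _ _ (w + 1 - 4 * i%:~R)); first lra.
    by exists i => //; rewrite ger0_norm//; lra.
  move=> _ [i' _ <-]; have [h|h] := int_cases i i'.
    by apply: le_trans (ler_norm _); lra.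
  by rewrite distrC; apply: le_trans (ler_norm _); lra.
exists (-1); first by right.
rewrite jE j2 => w /andP[w1 w2].
rewrite (@inf_minimum _ _ (4 * i%:~R + 4 - (w + 1))); first lra.
  exists (i + 1) => //; rewrite intrD distrC ger0_norm; lra.
move=> _ [i' _ <-]; have [h|h] := int_cases i i'.
  by apply: le_trans (ler_norm _); lra.
by rewrite distrC; apply: le_trans (ler_norm _); lra.
Qed.

Lemma boundary_cell_exists (R : realType) (w : R) :
  exists j : int, 2 * j%:~R - 1 < w <= 2 * j%:~R + 1.
Proof.
exists (Num.ceil ((w - 1) / 2)).
by have := ceil_itv ((w - 1) / 2); rewrite intrD mulrN1z => /andP[? ?]; apply/andP; split; lra.
Qed.

Lemma boundary_map_phase (R : realType) bc (w : R) : phase (boundary_map bc w).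
Proof.
have [j jw] := boundary_cell_exists w; have [s s1 sE] := boundary_map_cell R bc j.
rewrite sE// /phase /= in_itv /=; case/andP: jw => ? ?.
by case: s1 => ->; apply/andP; split; lra.
Qed.

Lemma measurable_affine (R : realType) (a b : R) :
  measurable_fun setT (fun x : R => a * x + b).
Proof. by apply: measurable_funD => //; exact: measurable_funM. Qed.

Lemma measurable_boundary_map (R : realType) bc :
  measurable_fun setT (@boundary_map R bc).
Proof.
move=> _ A mA; rewrite setTI.
pose c (j : int) : set R := `]2 * j%:~R - 1, 2 * j%:~R + 1]%classic.
rewrite (_ : _ @^-1` A =
    \bigcup_(j in [set: int]) (c j `&` boundary_map bc @^-1` A)); last first.
  rewrite -setI_bigcupl; apply/esym/setIidr => w _.
  have [j jw] := boundary_cell_exists w; exists j => //.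
apply: countable_bigcupT_measurable => // j.
have [s _ sE] := boundary_map_cell R bc j.
rewrite (_ : _ `&` _ =
    c j `&` (fun x => s * x + - (s * (2 * j%:~R))) @^-1` A); last first.
  apply/seteqP; split=> w [cw /= h]; split => //; move: (cw) h;
    by rewrite /c /= in_itv/= => cw' h; rewrite ?sE// in h *; rewrite ?mulrBr// in h *.
apply: measurableI; first exact: measurable_itv.
have := @measurable_affine R s (- (s * (2 * j%:~R))) measurableT A mA.
by rewrite setTI.
Qed.

Lemma affine_preimage_itv (R : realType) (a b u v : R) : a != 0 ->
  lebesgue_measure ((fun x : R => (a * x + b)%R) @^-1` `]u, v]%classic) =
  lebesgue_measure (`](u - b) / `|a|, (v - b) / `|a|]%classic : set R).
Proof.
rewrite neq_lt => /orP[a0|a0]; last first.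
  rewrite gtr0_norm//; congr (lebesgue_measure _).
  apply/seteqP; split => x /=; rewrite !in_itv/= ltr_pdivrMr// ler_pdivlMr// mulrC;
    by move=> /andP[? ?]; apply/andP; split; lra.
rewrite ltr0_norm//.
rewrite (_ : _ @^-1` _ = `[(v - b) / a, (u - b) / a[%classic); last first.
  apply/seteqP; split => x /=; rewrite !in_itv/= ltr_ndivlMr// ler_ndivrMr// mulrC;
    by move=> /andP[? ?]; apply/andP; split; lra.
rewrite !lebesgue_measure_itv/= !lte_fin !invrN !mulrN ltrN2; case: ifPn => // _.
by rewrite -?EFinN -?EFinD; congr EFin; rewrite opprK addrC.
Qed.

Lemma lebesgue_measure_affine (R : realType) (a b : R) (A : set R) : a != 0 ->
  measurable A ->
  (`|a|%:E * lebesgue_measure ((fun x : R => (a * x + b)%R) @^-1` A) = lebesgue_measure A)%E.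
Proof.
move=> a0 mA.
pose f (x : measurableTypeR R) : measurableTypeR R := a * x + b.
have mf : measurable_fun setT f by exact: measurable_affine.
pose image : {measure set (measurableTypeR R) -> \bar R} :=
  measure_function_pushforward__canonical__measure_function_Measure
    lebesgue_measure mf.
transitivity (mscale (NngNum (normr_ge0 a)) image A); first by [].
apply/esym/lebesgue_measure_unique => // _ [[u v]] _ <-.
pose J : set R := `]u, v]%classic.
transitivity (`|a|%:E * lebesgue_measure ((fun x : R => (a * x + b)%R) @^-1` J))%E;
  last by [].
rewrite affine_preimage_itv//= !lebesgue_measure_itv/= !lte_fin.
rewrite ltr_pM2r ?invr_gt0 ?normr_gt0// ltrBlDr subrK; case: ifPn => _; last by rewrite mule0.
rewrite -!EFinB -EFinM; congr EFin.
rewrite -mulrBl mulrCA divff ?normr_eq0// mulr1; lra.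
Qed.

Lemma ge0_integral_affine (R : realType) (a b : R) (f : R -> \bar R) : a != 0 ->
  measurable_fun setT f -> (forall x, 0 <= f x)%E ->
  (`|a|%:E * \int[lebesgue_measure]_x f (a * x + b)%R =
   \int[lebesgue_measure]_x f x)%E.
Proof.
move=> a0 mf f0.
pose g (x : measurableTypeR R) : measurableTypeR R := a * x + b.
have mg : measurable_fun setT g by exact: measurable_affine.
pose image : {measure set (measurableTypeR R) -> \bar R} :=
  measure_function_pushforward__canonical__measure_function_Measure
    lebesgue_measure mg.
transitivity (\int[mscale (NngNum (normr_ge0 a)) image]_x f x)%E.
  rewrite ge0_integral_mscale//=; congr (_ * _)%E.
  by rewrite ge0_integral_pushforward.
apply: eq_measure_integral => A mA _.
exact: lebesgue_measure_affine.
Qed.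

(** * The noise kernel *)

Lemma noise_modulus (R : realType) (rho : R -> R) : mother_noise_kernel rho ->
  exists (M : R) (V : R -> R), [/\ nondecreasing_fun V, forall x, 0 <= V x <= M &
    forall a b, a <= b -> `|rho b - rho a| <= V b - V a].
Proof.
move=> [[M MTV] _ rho0 _].
have TVfin a b : a <= b -> total_variation a b rho \is a fin_num.
  move=> ab; rewrite ge0_fin_numE ?total_variation_ge0//.
  exact: le_lt_trans (MTV _ _ ab) (ltry _).
have m2 x : - 2 <= Num.max (- 2) x :> R by rewrite le_max lexx.
pose V x := fine (total_variation (- 2) (Num.max (- 2) x) rho).
have VD a b : a <= b -> V b - V a =
    fine (total_variation (Num.max (- 2) a) (Num.max (- 2) b) rho).
  move=> ab.
  have mab : Num.max (- 2) a <= Num.max (- 2) b :> R.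
    by rewrite ge_max m2/= le_max ab orbT.
  by rewrite /V (total_variationD _ (m2 a) mab) fineD ?TVfin// addrAC subrr add0r.
have rhom x : rho (Num.max (- 2) x) = rho x.
  rewrite maxEle; case: ifPn => //; rewrite -ltNge => x2.
  by rewrite !rho0//; apply/negP => /andP[]; lra.
have Vrho a b : a <= b -> `|rho b - rho a| <= V b - V a.
  move=> ab.
  have mab : Num.max (- 2) a <= Num.max (- 2) b :> R.
    by rewrite ge_max m2/= le_max ab orbT.
  rewrite VD// -lee_fin fineK ?TVfin// -(rhom a) -(rhom b).
  exact: total_variation_ge.
exists M, V; split => //.
- by move=> a b ab; rewrite -subr_ge0; apply: le_trans (Vrho _ _ ab).
- move=> x; rewrite /V fine_ge0 ?total_variation_ge0//=.
  by rewrite -lee_fin fineK ?TVfin//; exact: MTV.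
Qed.

Lemma nondecreasing_continuous_countable (R : realType) (V : R -> R) (a b : R) :
  nondecreasing_fun V ->
  countable [set x | x \in (`]a, b[) /\ ~ {for x, continuous V}].
Proof.
move=> ndV.
have ndV' : {in `[a, b] &, nondecreasing_fun V} by move=> x y _ _; exact: ndV.
apply: sub_countable (discontinuity_countable ndV').
apply: subset_card_le => x [xab ncont]; split => //.
have cl : cvg (V y @[y --> x^'-]).
  apply: nondecreasing_at_left_is_cvgr; near=> y; first by move=> u v _ _; exact: ndV.
  exists (V x) => _ /= [z /[!in_itv]/= /andP[_ zx] <-]; exact/ndV/ltW.
have cr : cvg (V y @[y --> x^'+]).
  apply: nondecreasing_at_right_is_cvgr; near=> y; first by move=> u v _ _; exact: ndV.
  exists (V x) => _ /= [z /[!in_itv]/= /andP[xz _] <-]; exact/ndV/ltW.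
split => //; apply/eqP => lr; apply: ncont.
have le1 : lim (V y @[y --> x^'-]) <= V x.
  by apply: limr_le => //; near=> y; exact/ndV/ltW.
have le2 : V x <= lim (V y @[y --> x^'+]).
  by apply: limr_ge => //; near=> y; exact/ndV/ltW.
have E : V x = lim (V y @[y --> x^'+]).
  by apply/eqP; rewrite eq_le le2 -lr.
by apply/left_right_continuousP; split; rewrite E // -lr.
Unshelve. all: end_near. Qed.

Section mother_noise.
Context (R : realType) (rho : R -> R).
Hypothesis Hrho : mother_noise_kernel rho.

Lemma noise_ge0 x : 0 <= rho x.
Proof.
have [_ [c c0 rc] r0 _] := Hrho.
have [x1|x1] := boolP (-1 <= x <= 1); last by rewrite r0.
exact: le_trans (ltW c0) (rc _ x1).
Qed.

Lemma measurable_noise : measurable_fun setT rho.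
Proof.
have [M [V [ndV _ rhoV]]] := noise_modulus Hrho.
rewrite (_ : rho = V \- (V \- rho)); last by apply/funext => x /=; rewrite subKr.
apply: measurable_funB; apply: nondecreasing_measurable => // a b ab /=.
by have := le_trans (ler_norm _) (rhoV _ _ ab); lra.
Qed.

Lemma noise_continuous_out x : 1 < `|x| -> {for x, continuous rho}.
Proof.
move=> x1; have [_ _ rho0 _] := Hrho.
have out y : 1 < `|y| -> rho y = 0.
  by move=> y1; apply: rho0; rewrite -ler_norml -ltNge.
rewrite /prop_for /continuous_at (out _ x1).
apply: cvg_near_cst; near=> y; apply: out.
near: y; apply: (cvgr_gt `|x|) => //.
exact: norm_continuous.
Unshelve. all: end_near. Qed.

Lemma noise_discontinuities_countable :
  countable [set x | ~ {for x, continuous rho}].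
Proof.
have [M [V [ndV _ rhoV]]] := noise_modulus Hrho.
apply: sub_countable (nondecreasing_continuous_countable (- 2) 2 ndV).
apply: subset_card_le => x ncont; split; last first.
  apply: contra_not ncont => cV; apply/cvgrPdist_lt => e e0.
  have /cvgrPdist_lt/(_ e e0) h := cV.
  apply: filterS h => y; apply: le_lt_trans.
  have [xy|/ltW yx] := leP x y.
    by rewrite distrC [leRHS]distrC; apply: le_trans (rhoV _ _ xy) (ler_norm _).
  by apply: le_trans (rhoV _ _ yx) (ler_norm _).
rewrite in_itv/= -ltr_norml; apply: contrapT => /negP; rewrite -leNgt => x2.
by apply: ncont; apply: noise_continuous_out; lra.
Qed.

Lemma integral_noise : (\int[lebesgue_measure]_x (rho x)%:E = 1)%E.
Proof.
have [_ _ r0 <-] := Hrho.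
rewrite [RHS]integral_mkcond; apply: eq_integral => x _.
rewrite patchE; case: ifPn => //; rewrite notin_setE/= in_itv/= => /negP x1.
by rewrite r0.
Qed.

Lemma noise_bounded M V : (forall x, 0 <= V x <= M) ->
  (forall a b, a <= b -> `|rho b - rho a| <= V b - V a) -> forall x, rho x <= M.
Proof.
move=> V0M rhoV x; have [_ _ rho0 _] := Hrho.
have M0 : 0 <= M by have /andP[] := V0M 0; lra.
have [x2|x2] := leP (- 2) x; last first.
  by rewrite rho0//; apply/negP => /andP[]; lra.
have r2 : rho (- 2) = 0 by rewrite rho0//; apply/negP => /andP[]; lra.
have := rhoV _ _ x2; rewrite r2 subr0 => h.
have := le_trans (ler_norm _) h.
by have /andP[] := V0M x; have /andP[] := V0M (- 2); lra.
Qed.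

End mother_noise.

Section noise_kernel.
Context (R : realType) (rho : R -> R) (bc : boundary).
Hypothesis Hrho : mother_noise_kernel rho.
Local Notation leb := (@lebesgue_measure R).

Lemma rescaled_ge0 xi y : 0 < xi -> 0 <= rescaled_kernel rho xi y.
Proof.
move=> xi0; apply: mulr_ge0; first by rewrite invr_ge0 ltW.
exact: noise_ge0 Hrho _.
Qed.

Lemma measurable_rescaled xi : measurable_fun setT (rescaled_kernel rho xi).
Proof.
apply: measurable_funM => //; apply: measurableT_comp; first exact: (measurable_noise Hrho).
exact: measurable_funM.
Qed.

Lemma integral_rescaled xi : 0 < xi ->
  (\int[leb]_y (rescaled_kernel rho xi y)%:E = 1)%E.
Proof.
move=> xi0; rewrite -(integral_noise Hrho).
rewrite -(@ge0_integral_affine _ xi^-1 0 (EFin \o rho)) ?invr_neq0 ?gt_eqF//; last 2 first.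
- by apply/measurable_EFinP; exact: (measurable_noise Hrho).
- by move=> x; rewrite lee_fin (noise_ge0 Hrho).
rewrite gtr0_norm ?invr_gt0// -ge0_integralZl//=; last 3 first.
- apply/measurable_EFinP; apply: measurableT_comp; first exact: (measurable_noise Hrho).
  exact: measurable_affine.
- by move=> x _; rewrite lee_fin (noise_ge0 Hrho).
- by rewrite lee_fin invr_ge0 ltW.
by apply: eq_integral => x _ /=; rewrite -EFinM addr0 [xi^-1 * x]mulrC.
Qed.

Definition noise_transition (xi t : R) (A : set R) : \bar R :=
  (\int[leb]_y (rescaled_kernel rho xi y * \1_A (boundary_map bc (t + y)))%:E)%E.

Lemma measurable_noise_transition_fun xi (A : set R) : measurable A ->
  measurable_fun [set: measurableTypeR R * measurableTypeR R]
    (fun z => (rescaled_kernel rho xi z.2 * \1_A (boundary_map bc (z.1 + z.2)))%:E).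
Proof.
move=> mA; apply/measurable_EFinP; apply: measurable_funM.
  by apply: measurableT_comp; [exact: measurable_rescaled|exact: measurable_snd].
apply: (measurableT_comp (measurable_indic mA)).
apply: (measurableT_comp (measurable_boundary_map bc)).
by apply: measurable_funD; [exact: measurable_fst|exact: measurable_snd].
Qed.

Variables (xi : R) (xi0 : 0 < xi) (S : measurableTypeR R -> measurableTypeR R).
Hypothesis mS : measurable_fun setT S.

Let integrand_ge0 t A y :
  (0 <= (rescaled_kernel rho xi y * \1_A (boundary_map bc (t + y)))%:E)%E.
Proof. by rewrite lee_fin mulr_ge0// rescaled_ge0. Qed.

Lemma measurable_integrand t (A : set R) : measurable A ->
  measurable_fun setT
    (fun y => (rescaled_kernel rho xi y * \1_A (boundary_map bc (t + y)))%:E).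
Proof.
by move=> mA; exact: measurable_fun_pair2 (measurable_noise_transition_fun xi mA).
Qed.

Let transition_set0 t : noise_transition xi t set0 = 0%E.
Proof.
by rewrite /noise_transition integral0_eq// => y _; rewrite indic0 mulr0.
Qed.

Let transition_ge0 t A : (0 <= noise_transition xi t A)%E.
Proof. by apply: integral_ge0 => y _; exact: integrand_ge0. Qed.

Let transition_sigma_additive t : semi_sigma_additive (noise_transition xi t).
Proof.
move=> F mF tF mUF; rewrite /noise_transition [X in _ --> X](_ : _ =
    \int[leb]_y (\sum_(n <oo)
      (rescaled_kernel rho xi y * \1_(F n) (boundary_map bc (t + y)))%:E))%E; last first.
  apply: eq_integral => y _; under eq_eseriesr do rewrite EFinM.
  rewrite nneseriesZl//.
  by rewrite EFinM indic_bigcup.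
apply/cvg_closeP; split.
  by apply: is_cvg_nneseries => n _ _; exact: integral_ge0.
by rewrite closeE// integral_nneseries// => n; exact: measurable_integrand.
Qed.

Definition noise_measure (_ : mother_noise_kernel rho) (_ : 0 < xi) (t : R) :
  set (measurableTypeR R) -> \bar R := noise_transition xi t.

HB.instance Definition _ t := isMeasure.Build _ _ _
  (noise_measure Hrho xi0 t) (transition_set0 t) (transition_ge0 t)
  (@transition_sigma_additive t).

Lemma noise_transition_setT t : noise_transition xi t setT = 1%E.
Proof.
rewrite -(integral_rescaled xi0); apply: eq_integral => y _.
by rewrite indicT mulr1.
Qed.

Definition noise_kernel (_ : measurable_fun setT S) (x : measurableTypeR R) :
    {measure set (measurableTypeR R) -> \bar R} := noise_measure Hrho xi0 (S x).

Let measurable_noise_kernel U : measurable U ->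
  measurable_fun setT (noise_kernel mS ^~ U).
Proof.
move=> mU; have mf := measurable_noise_transition_fun xi mU.
have := @measurable_fun_fubini_tonelli_F _ _ _ _ _ lebesgue_measure _ mf.
move=> /(_ _)/measurableT_comp/(_ mS); apply => z.
by rewrite lee_fin mulr_ge0// rescaled_ge0.
Qed.

HB.instance Definition _ := isKernel.Build _ _ _ _ _ (noise_kernel mS)
  measurable_noise_kernel.

HB.instance Definition _ := Kernel_isProbability.Build _ _ _ _ _
  (noise_kernel mS) (fun x => noise_transition_setT (S x)).

End noise_kernel.

Definition boundary_cell (R : realType) (j : int) : set R :=
  `]2 * j%:~R - 1, 2 * j%:~R + 1]%classic.

Section noise_domination.
Context (R : realType) (rho : R -> R) (bc : boundary).
Hypothesis Hrho : mother_noise_kernel rho.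
Variables (M : R) (V : R -> R).
Hypothesis V0M : forall x, 0 <= V x <= M.
Hypothesis Vrho : forall a b, a <= b -> `|rho b - rho a| <= V b - V a.
Variables (xi : R) (xi0 : 0 < xi).
Local Notation leb := (@lebesgue_measure R).
Local Notation r := (rescaled_kernel rho xi).

Lemma lebesgue_measure_cell (j : int) (A : set R) : measurable A ->
  (leb (boundary_cell j `&` boundary_map bc @^-1` A) <=
   leb (phase `&` A))%E.
Proof.
move=> mA; have [s s1 sE] := boundary_map_cell R bc j.
have s0 : s != 0 by case: s1 => ->; rewrite ?oppr_eq0 oner_eq0.
have ns : `|s| = 1 by case: s1 => ->; rewrite ?normrN normr1.
have mpA : measurable (phase `&` A) by apply: measurableI => //; exact: measurable_itv.
rewrite -(lebesgue_measure_affine (- (s * (2 * j%:~R))) s0 mpA) ns mul1e.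
have mB := measurable_boundary_map bc measurableT mA; rewrite setTI in mB.
have mC := @measurable_affine R s (- (s * (2 * j%:~R))) measurableT _ mpA.
rewrite setTI in mC.
apply: le_measure.
- apply/mem_set; apply: measurableI => //; exact: measurable_itv.
- exact/mem_set.
- move=> w [/= jw pw]; rewrite /= -mulrBr -sE; last by move: jw; rewrite /boundary_cell /= in_itv.
  by split => //; exact: boundary_map_phase.
Qed.

(* On a cell the noise density oscillates by at most its variation there, so it
   is compared with its value at the left end of the cell. *)
Lemma noise_cell_le (t : R) (j : int) (A : set R) :
  measurable A ->
  (\int[leb]_(w in boundary_cell j) (r (w - t) * \1_A (boundary_map bc w))%:E <=
   leb (phase `&` A) * (2^-1%:E * \int[leb]_(w in boundary_cell j) (r (w - t))%:E +
   (2 / xi * (V ((2 * j%:~R + 1 - t) / xi) - V ((2 * j%:~R - 1 - t) / xi)))%:E))%E.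
Proof.
move=> mA; set c := boundary_cell j.
set a := 2 * j%:~R - 1; set b := 2 * j%:~R + 1.
pose v := xi^-1 * (V ((b - t) / xi) - V ((a - t) / xi)).
pose q0 := r (a - t).
have mc : measurable c by exact: measurable_itv.
have lebc : leb c = 2%:E.
  rewrite lebesgue_measure_itv/= lte_fin ifT; last by lra.
  by rewrite -EFinB; congr EFin; lra.
have osc w : c w -> `|r (w - t) - q0| <= v.
  rewrite /c /boundary_cell /= in_itv/= => /andP[aw wb].
  rewrite /q0 /r -mulrBr normrM gtr0_norm ?invr_gt0// ler_pM2l ?invr_gt0//.
  have ndV x y : x <= y -> V x <= V y.
    by move=> xy; rewrite -subr_ge0; apply: le_trans (Vrho xy).
  apply: le_trans (Vrho _) _.
    by rewrite ler_pM2r ?invr_gt0// lerD2r /a ltW.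
  by rewrite lerD2r; apply: ndV; rewrite ler_pM2r ?invr_gt0// lerD2r.
have mr : measurable_fun setT (fun w : R => r (w - t)).
  apply: measurableT_comp; first exact: measurable_rescaled.
  exact: measurable_funB.
have mi : measurable_fun setT (fun w : R => \1_A (boundary_map bc w) : R).
  by apply: measurableT_comp (measurable_boundary_map bc); exact: measurable_indic.
have r0 w : 0 <= r (w - t) by exact: rescaled_ge0.
have q00 : 0 <= q0 by exact: rescaled_ge0.
have v0 : 0 <= v.
  by apply: le_trans (osc b _) => //; rewrite /c /boundary_cell /= in_itv/= lexx andbT /b; lra.
have le1 : (\int[leb]_(w in c) (r (w - t) * \1_A (boundary_map bc w))%:E <=
    (q0 + v)%:E * leb (phase `&` A))%E.
  apply: (@le_trans _ _ (\int[leb]_(w in c) ((q0 + v)%:E * (\1_A (boundary_map bc w))%:E)))%E.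
    apply: ge0_le_integral => //.
    - by move=> w _; rewrite lee_fin mulr_ge0.
    - by apply/measurable_EFinP; apply: measurable_funTS; exact: measurable_funM.
    - apply/measurable_EFinP; apply: measurable_funTS.
      exact: measurable_funM.
    - move=> w cw; rewrite -EFinM lee_fin ler_wpM2r//.
      by have := osc _ cw; rewrite ler_norml => /andP[]; lra.
  rewrite ge0_integralZl//; last 2 first.
  - by apply/measurable_EFinP; exact: measurable_funTS.
  - by rewrite lee_fin addr_ge0.
  rewrite lee_wpmul2l ?lee_fin ?addr_ge0//.
  have mB := measurable_boundary_map bc measurableT mA; rewrite setTI in mB.
  rewrite (_ : (fun w : R => (\1_A (boundary_map bc w))%:E) =
    (fun w : R => (\1_(boundary_map bc @^-1` A) w)%:E)) //.
  by rewrite integral_indic// setIC; exact: lebesgue_measure_cell.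
have le2 : ((2 * q0)%:E <= \int[leb]_(w in c) (r (w - t))%:E + (2 * v)%:E)%E.
  apply: (@le_trans _ _ (\int[leb]_(w in c) ((r (w - t))%:E + v%:E))%E).
    rewrite mulrC EFinM -lebc -integral_cst//.
    apply: ge0_le_integral => //.
    - by apply/measurable_EFinP; apply: measurable_funTS; exact: measurable_funD.
    - move=> w cw; rewrite -EFinD lee_fin.
      by have := osc _ cw; rewrite ler_norml => /andP[]; lra.
  rewrite ge0_integralD//; last 2 first.
  - by move=> w _; rewrite lee_fin.
  - by apply/measurable_EFinP; exact: measurable_funTS.
  rewrite (_ : \int[leb]_(w in c) v%:E = (2 * v)%:E)%E//.
  by rewrite integral_cst// [X in (_ * X)%E]lebc -EFinM mulrC.
apply: le_trans le1 _; rewrite muleC lee_wpmul2l ?measure_ge0//.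
have lec0 : (0 <= \int[leb]_(w in c) (r (w - t))%:E)%E.
  by apply: integral_ge0 => w _; rewrite lee_fin.
have -> : 2 / xi * (V ((b - t) / xi) - V ((a - t) / xi)) = 2 * v.
  exact: (esym (mulrA _ _ _)).
case: (\int[leb]_(w in c) (r (w - t))%:E)%E le2 lec0 => [s| |].
- rewrite -EFinD lee_fin => h _; rewrite -[(2^-1%:E * _)%E]EFinM -EFinD lee_fin; lra.
- by move=> _ _; rewrite gt0_muley ?lte_fin// leey.
- by move=> _; rewrite leeNy_eq.
Qed.

Lemma noise_cells_le (t : R) (e0 : int) (N : nat) (A : set R) :
  measurable A ->
  let a := 2 * e0%:~R - 1 in let b := a + 2 * N%:R in
  (\int[leb]_(w in `]a, b]) (r (w - t) * \1_A (boundary_map bc w))%:E <=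
   leb (phase `&` A) * (2^-1%:E * \int[leb]_(w in `]a, b]) (r (w - t))%:E +
   (2 / xi * (V ((b - t) / xi) - V ((a - t) / xi)))%:E))%E.
Proof.
move=> mA; set a := 2 * e0%:~R - 1; cbv zeta.
have mr : measurable_fun setT (fun w : R => r (w - t)).
  apply: measurableT_comp; first exact: measurable_rescaled.
  exact: measurable_funB.
have mi : measurable_fun setT (fun w : R => \1_A (boundary_map bc w) : R).
  by apply: measurableT_comp (measurable_boundary_map bc); exact: measurable_indic.
have r0 w : 0 <= r (w - t) by exact: rescaled_ge0.
have ndV x y : x <= y -> V x <= V y.
  by move=> xy; rewrite -subr_ge0; apply: le_trans (Vrho xy).
elim: N => [|N IH] /=.
  rewrite mulr0 addr0 set_itv_ge ?bnd_simp ?ltxx// !integral_set0 subrr mulr0 mule0.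
  by rewrite add0e mule0.
set b := a + 2 * N%:R in IH *.
have bE : a + 2 * N.+1%:R = 2 * (e0 + N%:Z)%:~R + 1.
  by rewrite intrD -pmulrn -natr1 /a; lra.
have b'E : b = 2 * (e0 + N%:Z)%:~R - 1.
  by rewrite intrD -pmulrn /b /a; lra.
have ab : a <= b by rewrite lerDl mulr_ge0.
set b' := a + 2 * N.+1%:R in bE *.
have bb' : b <= b' by rewrite bE b'E; lra.
have UE : `]a, b']%classic = `]a, b]%classic `|` boundary_cell (e0 + N%:Z).
  by rewrite /boundary_cell -bE -b'E; apply: itv_bndbnd_setU; rewrite bnd_simp.
have disj : [disjoint `]a, b]%classic & boundary_cell (e0 + N%:Z)].
  apply/disj_setPS => x [/=]; rewrite /boundary_cell /= !in_itv/= -b'E.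
  by move=> /andP[_ xb] /andP[bx _]; move: (le_lt_trans xb bx); rewrite ltxx.
have mU1 : measurable (`]a, b]%classic : set R) by exact: measurable_itv.
have mU2 : measurable (boundary_cell (e0 + N%:Z) : set R) by exact: measurable_itv.
rewrite UE !ge0_integral_setU//; last 4 first.
- by apply/measurable_EFinP; exact: measurable_funTS.
- by move=> w _; rewrite lee_fin.
- by apply/measurable_EFinP; apply: measurable_funTS; exact: measurable_funM.
- by move=> w _; rewrite lee_fin mulr_ge0.
have := leeD IH (noise_cell_le t (e0 + N%:Z) mA).
rewrite -bE -b'E; move=> h; apply: le_trans h _.
have i0 (J : set R) : (0 <= \int[leb]_(w in J) (r (w - t))%:E)%E.
  by apply: integral_ge0 => w _; rewrite lee_fin.
have v0 x y : x <= y -> (0 <= (2 / xi * (V ((y - t) / xi) - V ((x - t) / xi)))%:E)%E.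
  move=> xy; rewrite lee_fin mulr_ge0//; first by rewrite divr_ge0// ltW.
  by rewrite subr_ge0 ndV// ler_pM2r ?invr_gt0// lerD2r.
have p2 (x : \bar R) : (0 <= x -> 0 <= 2^-1%:E * x)%E by move=> x0; rewrite mule_ge0.
rewrite -ge0_muleDr; [|by rewrite adde_ge0 ?p2 ?v0..].
rewrite addeACA -ge0_muleDr// -EFinD -mulrDr.
rewrite (_ : V ((b - t) / xi) - V ((a - t) / xi) +
  (V ((b' - t) / xi) - V ((b - t) / xi)) =
  V ((b' - t) / xi) - V ((a - t) / xi)) //; lra.
Qed.

Lemma noise_transition_le (t : R) (A : set R) : phase t -> measurable A ->
  (noise_transition rho bc xi t A <=
   (2^-1 + 2 / xi * M)%:E * leb (phase `&` A))%E.
Proof.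
rewrite /phase /= in_itv/= => /andP[t1 t2] mA.
have mr : measurable_fun setT (fun w : R => r (w - t)).
  apply: measurableT_comp; first exact: measurable_rescaled.
  exact: measurable_funB.
have mi : measurable_fun setT (fun w : R => \1_A (boundary_map bc w) : R).
  by apply: measurableT_comp (measurable_boundary_map bc); exact: measurable_indic.
have r0 w : 0 <= r (w - t) by exact: rescaled_ge0.
have shift (f : R -> R) : measurable_fun setT f -> (forall x, 0 <= f x) ->
    (\int[leb]_y (f (y + t))%:E = \int[leb]_w (f w)%:E)%E.
  move=> mf f0; have mf' : measurable_fun setT (EFin \o f) by exact/measurable_EFinP.
  have := @ge0_integral_affine _ 1 t (EFin \o f) (oner_neq0 _) mf' (fun x => f0 x).
  rewrite normr1 mul1e => <-.
  by apply: eq_integral => y _; rewrite /= mul1r.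
pose n := (Num.truncn (xi + 1)).+1.
have n1 : xi + 1 < n%:R by exact: truncnS_gt.
have := noise_cells_le t (- n%:Z) n.*2.+1 mA; cbv zeta.
set a := 2 * (- n%:Z)%:~R - 1.
have aE : a = - (2 * n%:R) - 1 by rewrite /a mulrNz -pmulrn; lra.
have -> : a + 2 * n.*2.+1%:R = 2 * n%:R + 1.
  have -> : n.*2.+1%:R = 2 * n%:R + 1 :> R.
    by rewrite -addn1 natrD -muln2 natrM mulrC.
  by rewrite aE; lra.
set b := 2 * n%:R + 1 => le1.
have supp w : ~ (a < w <= b) -> r (w - t) = 0.
  move=> h; have [_ _ rho0 _] := Hrho; rewrite /r rho0 ?mulr0//.
  apply/negP => /andP[]; rewrite ler_pdivlMr// ler_pdivrMr// => h1 h2; apply: h.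
  by rewrite aE /b; apply/andP; split; lra.
have mkint (g : R -> R) : (forall w, ~ (a < w <= b) -> g w = 0) ->
    (\int[leb]_(w in `]a, b]) (g w)%:E = \int[leb]_w (g w)%:E)%E.
  move=> g0; rewrite integral_mkcond; apply: eq_integral => w _.
  rewrite patchE; case: ifPn => //; rewrite notin_setE /= in_itv /= => h.
  by rewrite g0.
have E1 : (noise_transition rho bc xi t A =
    \int[leb]_(w in `]a, b]) (r (w - t) * \1_A (boundary_map bc w))%:E)%E.
  rewrite mkint; last by move=> w /supp ->; rewrite mul0r.
  rewrite -(shift (fun w => r (w - t) * \1_A (boundary_map bc w))).
  - by apply: eq_integral => y _; rewrite addrK addrC.
  - exact: measurable_funM.
  - by move=> w; rewrite mulr_ge0.
have E2 : (\int[leb]_(w in `]a, b]) (r (w - t))%:E = 1)%E.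
  rewrite mkint// -(shift (fun w => r (w - t)))// -(integral_rescaled Hrho xi0).
  by apply: eq_integral => y _; rewrite addrK.
rewrite E1; apply: le_trans le1 _; rewrite E2 mule1 muleC -EFinD.
rewrite lee_wpmul2r// lee_fin lerD2l ler_wpM2l//.
  by rewrite divr_ge0// ltW.
by have /andP[] := V0M ((b - t) / xi); have /andP[] := V0M ((a - t) / xi); lra.
Qed.

End noise_domination.

Section noise_amplitude.
Context (R : realType) (rho : R -> R) (bc : boundary).
Hypothesis Hrho : mother_noise_kernel rho.
Local Notation leb := (@lebesgue_measure R).
Local Notation r := (rescaled_kernel rho).

Lemma rescaled_out xi y : 0 < xi -> xi < `|y| -> r xi y = 0.
Proof.
move=> xi0 y1; have [_ _ rho0 _] := Hrho; rewrite /rescaled_kernel rho0 ?mulr0//.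
by rewrite -ler_norml -ltNge normrM normfV (gtr0_norm xi0) ltr_pdivlMr ?mul1r.
Qed.

Lemma rescaled_le xi M y : 0 < xi -> (forall x, rho x <= M) -> r xi y <= M / xi.
Proof.
by move=> xi0 rM; rewrite mulrC ler_pM2l ?invr_gt0.
Qed.

Lemma noise_transition_null xi1 xi2 t A : 0 < xi2 <= xi1 -> measurable A ->
  noise_transition rho bc xi1 t A = 0%E -> noise_transition rho bc xi2 t A = 0%E.
Proof.
move=> /andP[xi20 xi21] mA h; have xi10 : 0 < xi1 by exact: lt_le_trans xi21.
have [M [V [_ V0M rhoV]]] := noise_modulus Hrho.
have rM := noise_bounded Hrho V0M rhoV.
have [_ [c c0 rc] _ _] := Hrho.
have M0 : 0 <= M by apply: le_trans (rM 0); exact: (noise_ge0 Hrho).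
pose C := M / xi2 * (xi1 / c).
have C0 : 0 <= C by rewrite mulr_ge0// divr_ge0// ltW.
have rC y : r xi2 y <= C * r xi1 y.
  have [y2|y2] := ltP xi2 `|y|.
    by rewrite rescaled_out// mulr_ge0//; exact: rescaled_ge0.
  apply: le_trans (rescaled_le _ xi20 rM) _; rewrite /C -mulrA ler_peMr//.
    by rewrite divr_ge0// ltW.
  rewrite /rescaled_kernel [xi1 / c]mulrC mulrA mulfK ?gt_eqF//.
  rewrite ler_pdivlMl// mulr1; apply: rc.
  rewrite -ler_norml normrM normfV (gtr0_norm xi10) ler_pdivrMr// mul1r.
  exact: le_trans xi21.
apply/eqP; rewrite eq_le; apply/andP; split; last first.
  by apply: integral_ge0 => y _; rewrite lee_fin mulr_ge0//; exact: rescaled_ge0.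
apply: (@le_trans _ _ (C%:E * noise_transition rho bc xi1 t A)%E); last by rewrite h mule0.
rewrite /noise_transition -ge0_integralZl//; last 2 first.
- exact: (measurable_integrand bc Hrho).
- by move=> y _; rewrite lee_fin mulr_ge0//; exact: rescaled_ge0.
apply: ge0_le_integral => //.
- by move=> y _; rewrite lee_fin mulr_ge0//; exact: rescaled_ge0.
- exact: (measurable_integrand bc Hrho).
- apply: measurable_funeM; exact: (measurable_integrand bc Hrho).
- by move=> y _; rewrite -EFinM lee_fin mulrA ler_wpM2r.
Qed.

Lemma rescaled_L1_continuous (xi_ : nat -> R) xi l b : 0 < l ->
  (forall n, l <= xi_ n <= b) -> xi_ n @[n --> \oo] --> xi ->
  (\int[leb]_y `|(r (xi_ n) y)%:E - (r xi y)%:E|)%E @[n --> \oo] --> 0%E.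
Proof.
move=> l0 lb cxi.
have xi_0 n : 0 < xi_ n by have /andP[+ _] := lb n; exact: lt_le_trans.
have lxi : l <= xi.
  rewrite -(cvg_lim _ cxi)//; apply: limr_ge; first by apply/cvg_ex; exists xi.
  by apply: nearW => n; have /andP[] := lb n.
have [M [V [_ V0M rhoV]]] := noise_modulus Hrho.
have rM := noise_bounded Hrho V0M rhoV.
have M0 : 0 <= M by apply: le_trans (rM 0); exact: (noise_ge0 Hrho).
have xi0 : 0 < xi by exact: lt_le_trans lxi.
pose D := [set x | ~ {for x, continuous rho}].
pose g (y : R) : R := M / l * \1_(`[- b, b]%classic : set R) y.
have cD : countable (( *%R xi) @` D).
  exact: sub_countable (card_image_le _ _) (noise_discontinuities_countable Hrho).
have aecvg : {ae leb, forall y, setT y -> (r (xi_ n) y)%:E @[n --> \oo] --> (r xi y)%:E}.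
  exists (( *%R xi) @` D); split.
  - by apply: countable_measurable cD => x; exact: measurable_set1.
  - exact: countable_lebesgue_measure0.
  move=> y /= h; apply: contrapT => yD; apply: h => _.
  apply: cvg_EFin; first exact: nearW.
  have cy : {for y / xi, continuous rho}.
    apply: contrapT => ny; apply: yD; exists (y / xi) => //.
    by rewrite mulrC divfK// gt_eqF.
  have cinv : (xi_ n)^-1 @[n --> \oo] --> xi^-1.
    by apply: cvgV => //; rewrite gt_eqF.
  have cq : y / xi_ n @[n --> \oo] --> y / xi by apply: cvgM cinv; exact: cvg_cst.
  by apply: cvgM cinv _; exact: (continuous_cvg _ cy cq).
have ig : leb.-integrable setT (EFin \o g).
  rewrite (_ : EFin \o g =
    (fun y => (M / l)%:E * (\1_(`[- b, b]%classic : set R) y)%:E)%E) //.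
  apply: integrableZl => //; apply/integrableP; split.
    by apply/measurable_EFinP; exact: measurable_indic.
  under eq_integral do rewrite gee0_abs ?lee_fin//.
  rewrite integral_indic// setIT.
  apply: (@le_lt_trans _ _ (leb `[- b, b]%classic)) => //.
  by rewrite lebesgue_measure_itv; case: ifPn => _; rewrite /= -?EFinB ltry.
have dom : {ae leb, forall y n, setT y -> (`|(r (xi_ n) y)%:E| <= (EFin \o g) y)%E}.
  apply: aeW => y n _.
  have /andP[ln nb] := lb n.
  rewrite /= lee_fin ger0_norm; last exact: rescaled_ge0.
  rewrite /g /=; have [yb|yb] := leP `|y| b.
    rewrite indicE mem_set/=; last by rewrite in_itv/= -ler_norml.
    rewrite mulr1; apply: le_trans (rescaled_le _ (xi_0 n) rM) _.
    by rewrite ler_wpM2l// lef_pV2// ?posrE.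
  rewrite rescaled_out//; last exact: le_lt_trans yb.
  by rewrite mulr_ge0// divr_ge0// ltW.
have mr x : measurable_fun setT (fun y : measurableTypeR R => (r x y)%:E).
  by apply/measurable_EFinP; exact: measurable_rescaled.
by have [] := @dominated_convergence _ _ _ leb setT measurableT _ _ _
  (fun n => mr (xi_ n)) (mr xi) aecvg ig dom.
Qed.

End noise_amplitude.

(** * The annealed system *)

Lemma piecewise_measurable (R : realType) (b : R) (T : R -> R) (s : seq R) (a : R) :
  itv_partition a b s ->
  (forall i, (i < size s)%N ->
    forall x, nth b (a :: s) i < x < nth b s i -> derivable T x 1) ->
  measurable_fun (`[a, b]%classic : set R) T.
Proof.
elim: s a => [|c s IH] a.
  move=> [_ /eqP ab] _; rewrite -ab set_itv1; exact: measurable_fun_set1.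
move=> [/= /andP[ac pcs] lcs] derT.
have cb : c <= b by apply: itv_partition_le; split; first exact: pcs.
have -> : `[a, b]%classic = [set a] `|` `]a, c[%classic `|` `[c, b]%classic.
  apply/seteqP; split => [x|x] /=; rewrite !in_itv/=.
    move=> /andP[]; rewrite le_eqVlt => /orP[/eqP ->|ax] xb; first by left; left.
    by have [xc|xc] := ltP x c; [left; right|right; rewrite xb]; rewrite ?ax.
  move=> [[->|/andP[ax xc]]|/andP[cx xb]]; rewrite ?lexx ?(ltW ax)/=.
  - by rewrite (le_trans (ltW ac)).
  - by rewrite (le_trans (ltW xc)).
  - by rewrite xb (le_trans (ltW ac)).
apply/measurable_funU; [by apply: measurableU|exact: measurable_itv|].
split; last first.
  apply: IH; first by split.
  by move=> i si x; apply: (derT i.+1).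
apply/measurable_funU => //; split; first exact: measurable_fun_set1.
apply: open_continuous_measurable_fun; first exact: interval_open.
move=> x /set_mem /=; rewrite in_itv/= => acx.
by apply: differentiable_continuous; apply/derivable1_diffP; apply: (derT 0%N).
Qed.

Section annealed.
Context (R : realType) (T rho : R -> R) (bc : boundary).
Hypothesis T_phase : forall x, phase x -> phase (T x).
Hypothesis T_C1 : piecewise_C1 (-1) 1 T.
Hypothesis Hrho : mother_noise_kernel rho.
Local Notation leb := (@lebesgue_measure R).
Local Notation r := (rescaled_kernel rho).
Local Notation mR := (measurableTypeR R).

(* Outside of the phase space, where stationary measures have no mass, the map is
   replaced by 0 to obtain a kernel on the whole line. *)
Definition phase_map : mR -> mR := T \_ phase.

Lemma measurable_phase : measurable (phase : set mR).
Proof. exact: measurable_itv. Qed.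

Lemma measurable_phase_map : measurable_fun setT phase_map.
Proof.
have [s [abs derT]] := T_C1.
apply/(measurable_restrictT _ measurable_phase).
by apply: (piecewise_measurable abs) => i si x /(derT i si)[].
Qed.

Lemma phase_map_phase x : phase (phase_map x).
Proof.
rewrite /phase_map patchE; case: ifPn => [/set_mem/T_phase//|_].
by rewrite /phase /= in_itv/= -[point]/(0 : R); apply/andP; split; lra.
Qed.

Lemma annealed_transferE (xi : R) (xi0 : 0 < xi) (mu : lineProb R) (A : set R) :
  mu phase = 1%E -> measurable A ->
  annealed_transfer T rho bc xi mu A =
  markov_step (noise_kernel bc Hrho xi0 measurable_phase_map) mu A.
Proof.
move=> mu1 mA; have mS := measurable_phase_map.
have muC : mu (~` phase) = 0%E.
  by rewrite probability_setC ?mu1 ?subee//; exact: measurable_phase.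
rewrite /annealed_transfer gt_eqF// /boundary_measure /pushforward /conv_measure.
have innerE y : ext0_measure (transfer T mu)
      [set x | (boundary_map bc @^-1` A) (x + y)] =
    (\int[mu]_x (\1_A (boundary_map bc (phase_map x + y)))%:E)%E.
  pose B := [set x : mR | A (boundary_map bc (phase_map x + y))].
  have mB : measurable B.
    rewrite -[B]setTI.
    have : measurable_fun setT (fun x : mR => boundary_map bc (phase_map x + y)).
      apply: measurableT_comp; first exact: measurable_boundary_map.
      exact: measurable_funD.
    exact.
  transitivity (mu B); last first.
    by rewrite -[B]setIT -integral_indic.
  rewrite /ext0_measure /transfer.
  transitivity (mu (phase `&` B)).
    congr (mu _); apply/seteqP; split => x /= [px].
      by move=> [_ h]; split => //; rewrite /B /= /phase_map patchE mem_set.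
    rewrite /B /= /phase_map patchE mem_set// => h.
    by split => //; split => //; exact: T_phase.
  rewrite -[B in RHS](setIT B) -(setUv phase) setIUr measureU//; last 3 first.
  - by apply: measurableI => //; exact: measurable_phase.
  - by apply: measurableI => //; apply: measurableC; exact: measurable_phase.
  - by rewrite setIACA setICr setI0.
  rewrite [X in (_ + X)%E](_ : _ = 0%E) ?adde0 1?setIC//.
  apply: (subset_measure0 _ _ _ muC) => //.
  - by apply: measurableI => //; apply: measurableC; exact: measurable_phase.
  - by apply: measurableC; exact: measurable_phase.
pose F (z : mR * mR) : \bar R :=
  (r xi z.2 * \1_A (boundary_map bc (phase_map z.1 + z.2)))%:E.
have mF : measurable_fun setT F.
  have mpair : measurable_fun setT (fun z : mR * mR => (phase_map z.1, z.2)).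
    apply: measurable_fun_pair; last exact: measurable_snd.
    by apply: measurableT_comp mS _; exact: measurable_fst.
  exact: (measurableT_comp (measurable_noise_transition_fun bc Hrho xi mA) mpair).
have F0 z : (0 <= F z)%E by rewrite lee_fin mulr_ge0//; exact: rescaled_ge0.
have r0 y : 0 <= r xi y by exact: rescaled_ge0.
transitivity (\int[leb]_y \int[mu]_x F (x, y))%E.
  rewrite integral_mkcond; apply: eq_integral => y _.
  rewrite patchE; case: ifPn => [_|].
    rewrite innerE -ge0_integralZl//; last by rewrite lee_fin.
    apply/measurable_EFinP; apply: (measurableT_comp (measurable_indic mA)).
    apply: measurableT_comp; first exact: measurable_boundary_map.
    exact: measurable_funD.
  rewrite notin_setE/= in_itv/= -ler_norml => /negP; rewrite -ltNge => yxi.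
  by rewrite integral0_eq// => x _; rewrite /F /= (rescaled_out Hrho)// mul0r.
by rewrite -(fubini_tonelli F).
Qed.

Lemma stationary_invariant (xi : R) (xi0 : 0 < xi) (mu : lineProb R) :
  stationary T rho bc xi mu <->
  invariant (noise_kernel bc Hrho xi0 measurable_phase_map) mu.
Proof.
split=> [[mu1 st] A mA|inv]; first by rewrite -annealed_transferE// st.
have mu1 : mu phase = 1%E.
  rewrite -(inv _ measurable_phase) -[RHS](probability_setT mu) -(inv _ measurableT).
  apply: eq_integral => x _; apply: eq_integral => y _.
  by rewrite !indicE !mem_set//; exact: boundary_map_phase.
by split => // A mA; rewrite (annealed_transferE xi0)// inv.
Qed.

End annealed.

Lemma ltN11 (R : realType) : -1 < 1 :> R.
Proof. by rewrite gtrN. Qed.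

Definition phase_uniform (R : realType) : lineProb R := uniform_prob (@ltN11 R).

Section uniform_reference.
Context (R : realType).
Local Notation leb := (@lebesgue_measure R).

Lemma phase_uniform_integral (f : R -> \bar R) : measurable_fun setT f ->
  (forall x, 0 <= f x)%E ->
  (\int[phase_uniform R]_x f x = 2^-1%:E * \int[leb]_(x in phase) f x)%E.
Proof.
move=> mf f0; have -> : 2^-1 = (1 - -1)^-1 :> R by rewrite opprK.
exact: (integral_uniform (@ltN11 R) mf f0).
Qed.

Lemma phase_uniformE (A : set R) : measurable A ->
  (phase_uniform R A = 2^-1%:E * leb (phase `&` A))%E.
Proof.
move=> mA.
transitivity (\int[phase_uniform R]_x (\1_A x)%:E)%E.
  by rewrite integral_indic ?setIT.
rewrite phase_uniform_integral; last 2 first.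
- exact/measurable_EFinP.
- by move=> x; rewrite lee_fin.
by rewrite integral_indic 1?setIC//; exact: measurable_itv.
Qed.

Context (rho : R -> R) (bc : boundary).
Hypothesis Hrho : mother_noise_kernel rho.
Local Notation r := (rescaled_kernel rho).

Lemma noise_transition_dominated : exists2 M : R, 0 <= M &
  forall xi, 0 < xi -> forall t, phase t ->
  dominated_by (phase_uniform R) (1 + M / xi) (noise_transition rho bc xi t).
Proof.
have [M [V [_ V0M rhoV]]] := noise_modulus Hrho.
have M0 : 0 <= M by have /andP[] := V0M 0; lra.
exists (4 * M); first by rewrite mulr_ge0.
move=> xi xi0 t pt A mA.
apply: le_trans (noise_transition_le bc Hrho V0M rhoV xi0 pt mA) _.
apply: (@le_trans _ _ ((1 + 4 * M / xi)%:E * (2^-1%:E * leb (phase `&` A)))%E);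
  last by rewrite -phase_uniformE.
by rewrite muleA -EFinM lee_wpmul2r ?measure_ge0// lee_fin; lra.
Qed.

Lemma noise_transition_le1 xi t A : 0 < xi -> measurable A ->
  (noise_transition rho bc xi t A <= 1)%E.
Proof.
move=> xi0 mA; rewrite -(noise_transition_setT bc Hrho xi0 t).
apply: ge0_le_integral => //.
- by move=> y _; rewrite lee_fin mulr_ge0//; exact: rescaled_ge0.
- exact: (measurable_integrand bc Hrho).
- exact: (measurable_integrand bc Hrho).
- move=> y _; rewrite lee_fin ler_wpM2l//; first exact: rescaled_ge0.
  by rewrite indicT indicE; case: (_ \in _).
Qed.

Lemma noise_transition_ge0 xi t A : 0 < xi ->
  (0 <= noise_transition rho bc xi t A)%E.
Proof.
move=> xi0; apply: integral_ge0 => y _.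
by rewrite lee_fin mulr_ge0//; exact: rescaled_ge0.
Qed.

Lemma noise_transition_fin_num xi t A : 0 < xi -> measurable A ->
  noise_transition rho bc xi t A \is a fin_num.
Proof.
move=> xi0 mA; rewrite ge0_fin_numE ?noise_transition_ge0//.
exact: le_lt_trans (noise_transition_le1 _ xi0 mA) (ltry _).
Qed.

Lemma noise_transition_uniform (xi_ : nat -> R) xi l b (A : set R) e : 0 < l ->
  (forall n, l <= xi_ n <= b) -> xi_ n @[n --> \oo] --> xi -> l <= xi ->
  measurable A -> 0 < e -> \forall n \near \oo, forall t,
  `|fine (noise_transition rho bc xi t A) -
    fine (noise_transition rho bc (xi_ n) t A)| <= e.
Proof.
move=> l0 lb cxi lxi mA e0.
have /fine_cvgP[finL /cvgrPdist_le/(_ _ e0) leL] :=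
  rescaled_L1_continuous Hrho l0 lb cxi.
near=> n => t.
have xi0 : 0 < xi by exact: lt_le_trans lxi.
have xi_0 : 0 < xi_ n by have /andP[+ _] := lb n; exact: lt_le_trans.
pose f z y := (r z y * \1_A (boundary_map bc (t + y)))%:E.
have mf z : measurable_fun setT (f z) by exact: (measurable_integrand bc Hrho).
have intf z : 0 < z -> leb.-integrable setT (f z).
  move=> z0; have absE : (\int[leb]_y `|f z y| = noise_transition rho bc z t A)%E.
    apply: eq_integral => y _.
    by rewrite gee0_abs// lee_fin mulr_ge0//; exact: rescaled_ge0.
  apply/integrableP; split; first exact: mf.
  by rewrite absE; exact: le_lt_trans (noise_transition_le1 t z0 mA) (ltry _).
have fin1 := noise_transition_fin_num t xi0 mA.
have fin2 := noise_transition_fin_num t xi_0 mA.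
have finD : (noise_transition rho bc xi t A - noise_transition rho bc (xi_ n) t A)%E
    \is a fin_num by rewrite fin_numB fin1 fin2.
rewrite -fineB// -lee_fin -fine_abse// fineK ?abse_fin_num//.
have finLn : (\int[leb]_y `|(r (xi_ n) y)%:E - (r xi y)%:E|)%E \is a fin_num.
  by near: n.
have leLn : `|0 - fine (\int[leb]_y `|(r (xi_ n) y)%:E - (r xi y)%:E|)%E| <= e.
  by near: n.
apply: (@le_trans _ _ (\int[leb]_y `|(r (xi_ n) y)%:E - (r xi y)%:E|)%E); last first.
  rewrite -(fineK finLn) lee_fin; apply: le_trans leLn.
  by rewrite sub0r normrN ler_norm.
rewrite /noise_transition -/(f xi) -integralB//; [|exact: intf..].
have mr z : measurable_fun setT (fun y => (r z y)%:E).
  by apply/measurable_EFinP; exact: measurable_rescaled.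
apply: le_trans (le_abse_integral _ _ _) _ => //.
  by apply: emeasurable_funB; exact: mf.
apply: ge0_le_integral => //.
- by apply: measurableT_comp => //; apply: emeasurable_funB; exact: mf.
- by apply: measurableT_comp => //; apply: emeasurable_funB; exact: mr.
move=> y _; rewrite /f -!EFinB /= lee_fin -mulrBl normrM distrC ler_piMr//.
by rewrite indicE ger0_norm ?ler0n//; case: (_ \in _).
Unshelve. all: end_near. Qed.

Lemma noise_transition_mixing : exists2 M : R, 0 <= M &
  forall xi, 0 < xi -> forall t A, phase t -> measurable A ->
  `|fine (phase_uniform R A) - fine (noise_transition rho bc xi t A)| <= M / xi.
Proof.
have [M M0 dom] := noise_transition_dominated.
exists M => // xi xi0 t A pt mA.
have Mxi0 : 0 <= M / xi by rewrite divr_ge0// ltW.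
have upper B : measurable B ->
    fine (noise_transition rho bc xi t B) <= fine (phase_uniform R B) + M / xi.
  move=> mB; have fU := fin_num_measure (phase_uniform R) _ mB.
  have := dom _ xi0 _ pt _ mB.
  rewrite -{1}(fineK (noise_transition_fin_num t xi0 mB)) -{1}(fineK fU) -EFinM lee_fin.
  move=> h; apply: le_trans h _; rewrite mulrDl mul1r lerD2l ler_piMr//.
  by rewrite -lee_fin fineK//; exact: probability_le1.
have mC := measurableC mA.
have KC : fine (noise_transition rho bc xi t (~` A)) =
    1 - fine (noise_transition rho bc xi t A).
  have h : (noise_transition rho bc xi t setT = noise_transition rho bc xi t A +
      noise_transition rho bc xi t (~` A))%E.
    rewrite -[X in X = _]/(noise_measure bc Hrho xi0 t setT) -(setUCr A).
    by rewrite measureU// setICr.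
  move: h; rewrite (noise_transition_setT bc Hrho xi0 t).
  rewrite -{1}(fineK (noise_transition_fin_num t xi0 mA)).
  rewrite -{1}(fineK (noise_transition_fin_num t xi0 mC)) -EFinD => -[->].
  by rewrite addrAC subrr add0r.
have UC : fine (phase_uniform R (~` A)) = 1 - fine (phase_uniform R A).
  by rewrite probability_setC// fineB// fin_num_measure.
have := upper _ mA; have := upper _ mC; rewrite KC UC => h1 h2.
by rewrite ler_norml; apply/andP; split; lra.
Qed.

End uniform_reference.

Lemma integrable_of_integral d (X : measurableType d) (R : realType)
    (mu : {measure set X -> \bar R}) (D : set X) (h : X -> \bar R) :
  measurable D -> measurable_fun D h ->
  (-oo < \int[mu]_(x in D) h x < +oo)%E -> mu.-integrable D h.
Proof.
move=> mD mh; rewrite integralE => /andP[h1 h2].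
have p0 : (0 <= \int[mu]_(x in D) h^\+ x)%E by exact: integral_ge0.
have n0 : (0 <= \int[mu]_(x in D) h^\- x)%E by exact: integral_ge0.
have absE : (\int[mu]_(x in D) `|h x| =
    \int[mu]_(x in D) h^\+ x + \int[mu]_(x in D) h^\- x)%E.
  rewrite -ge0_integralD//; last 2 first.
  - exact: measurable_funepos.
  - exact: measurable_funeneg.
  by apply: eq_integral => x _; exact: (congr1 (fun g => g x) (fune_abse h)).
apply/integrableP; split => //; rewrite absE; move: p0 n0 h1 h2.
case: (\int[mu]_(x in D) h^\+ x)%E => [a| |]//;
  case: (\int[mu]_(x in D) h^\- x)%E => [b| |]// _ _ _ _.
by rewrite -EFinD ltry.
Qed.

Section lyapunov.
Context (R : realType) (T rho : R -> R) (bc : boundary) (mu0 : lineProb R).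
Hypothesis T_phase : forall x, phase x -> phase (T x).
Hypothesis T_C1 : piecewise_C1 (-1) 1 T.
Hypothesis Hrho : mother_noise_kernel rho.
Hypothesis mlog : measurable_fun phase (log_deriv T).
Hypothesis log_neg : (-oo <
  \int[lebesgue_measure]_(x in phase) (log_deriv T x * (2^-1)%:E) < 0)%E.
Local Notation leb := (@lebesgue_measure R).
Local Notation U := (phase_uniform R).
Local Notation kernel xi0 := (noise_kernel bc Hrho xi0 (measurable_phase_map T_C1)).
Local Notation f := (log_deriv T \_ phase).
Local Notation stat := (stationary_measure T rho bc mu0).
Local Notation lam := (lyapunov T rho bc mu0).

Lemma log_deriv_half_integrable :
  leb.-integrable phase (fun x => log_deriv T x * (2^-1)%:E)%E.
Proof.
apply: integrable_of_integral; [exact: measurable_phase| |].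
  apply: emeasurable_funM => //; exact: mlog.
by case/andP: log_neg => -> /= h; exact: lt_trans h (ltry _).
Qed.

Lemma log_deriv_integrable : leb.-integrable phase (log_deriv T).
Proof.
have := integrableZl (@measurable_phase R) 2 log_deriv_half_integrable.
apply: eq_integrable => //; first exact: measurable_phase.
by move=> x _; rewrite muleCA -EFinM divff ?mule1// pnatr_eq0.
Qed.

Lemma log_restrict_measurable : measurable_fun setT f.
Proof. by apply/(measurable_restrictT _ (@measurable_phase R)); exact: mlog. Qed.

Lemma phase_uniform_log : U.-integrable setT f /\
  (\int[U]_x f x = \int[leb]_(x in phase) (log_deriv T x * (2^-1)%:E))%E.
Proof.
have mf := log_restrict_measurable.
have mph := @measurable_phase R.
have fin_pos := integrable_pos_fin_num mph log_deriv_integrable.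
have fin_neg := integrable_neg_fin_num mph log_deriv_integrable.
have absfin : (\int[U]_x `|f x| < +oo)%E.
  rewrite phase_uniform_integral//; last exact: measurableT_comp.
  have -> : (\int[leb]_(x in phase) `|f x| =
      \int[leb]_(x in phase) `|log_deriv T x|)%E.
    by apply: eq_integral => x xp; rewrite patchE xp.
  have /integrableP[_ h] := log_deriv_integrable.
  by rewrite lte_mul_pinfty.
split; first by apply/integrableP.
rewrite integralZr//; last exact: log_deriv_integrable.
rewrite [LHS]integralE [in RHS]integralE.
rewrite phase_uniform_integral//; last exact: measurable_funepos.
rewrite phase_uniform_integral//; last exact: measurable_funeneg.
have -> : (\int[leb]_(x in phase) f^\+ x =
    \int[leb]_(x in phase) (log_deriv T)^\+ x)%E.
  by apply: eq_integral => x xp; rewrite funepos_restrict patchE xp.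
have -> : (\int[leb]_(x in phase) f^\- x =
    \int[leb]_(x in phase) (log_deriv T)^\- x)%E.
  by apply: eq_integral => x xp; rewrite funeneg_restrict patchE xp.
rewrite -(fineK fin_pos) -(fineK fin_neg); set a := fine _; set b := fine _.
by rewrite [RHS]muleC muleBr.
Qed.

Lemma noise_kernel_dominated : exists2 M : R, 0 <= M &
  forall l xi (xi0 : 0 < xi), 0 < l <= xi ->
  forall x, dominated_by U (1 + M / l) (kernel xi0 x).
Proof.
have [M M0 dom] := noise_transition_dominated bc Hrho.
exists M => // l xi xi0 /andP[l0 lxi] x A mA.
apply: le_trans (dom _ xi0 _ (phase_map_phase T_phase x) _ mA) _.
rewrite lee_wpmul2r ?measure_ge0// lee_fin lerD2l ler_wpM2l//.
by rewrite lef_pV2// posrE.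
Qed.

Lemma unique_stationary_of_invariant xi (xi0 : 0 < xi) :
  unique_invariant (kernel xi0) -> has_unique_stationary T rho bc xi.
Proof.
have [M M0 dom] := noise_kernel_dominated.
move=> uniq; split.
  have xi01 : 0 < xi <= xi by rewrite xi0 lexx.
  have C0 : 0 <= 1 + M / xi by rewrite addr_ge0// divr_ge0// ltW.
  have [mu [imu _]] := invariant_exists U C0 (dom xi xi xi0 xi01).
  by exists mu; apply/(stationary_invariant bc T_phase T_C1 Hrho xi0).
move=> mu nu /(stationary_invariant bc T_phase T_C1 Hrho xi0) imu.
move=> /(stationary_invariant bc T_phase T_C1 Hrho xi0) inu.
exact: uniq.
Qed.

Variables (l : R) (l0 : 0 < l).
Hypothesis unique_l : has_unique_stationary T rho bc l.

Lemma noise_kernel_unique xi (xi0 : 0 < xi) : l <= xi ->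
  unique_invariant (kernel xi0).
Proof.
move=> lxi; have [M M0 dom] := noise_kernel_dominated.
have C0 : 0 <= 1 + M / l by rewrite addr_ge0// divr_ge0// ltW.
have ll : 0 < l <= l by rewrite l0 lexx.
apply: (@unique_invariant_transfer _ _ _ U _ (kernel l0) _ C0 (dom l l l0 ll)).
  move=> x A mA; apply: noise_transition_null => //; exact/andP.
move=> mu nu imu inu; case: unique_l => _; apply.
  by apply/(stationary_invariant bc T_phase T_C1 Hrho l0).
by apply/(stationary_invariant bc T_phase T_C1 Hrho l0).
Qed.

Lemma stationary_measure_invariant xi (xi0 : 0 < xi) : l <= xi ->
  invariant (kernel xi0) (stat xi).
Proof.
move=> lxi; apply/(stationary_invariant bc T_phase T_C1 Hrho xi0).
rewrite /stationary_measure gt_eqF//.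
have [[mu smu] _] := unique_stationary_of_invariant (@noise_kernel_unique _ xi0 lxi).
exact: (xgetPex _ (ex_intro _ mu smu)).
Qed.

Lemma stationary_measure_dominated : exists2 M : R, 0 <= M &
  forall xi, l <= xi -> dominated_by U M (stat xi).
Proof.
have [M M0 dom] := noise_kernel_dominated.
have C0 : 0 <= 1 + M / l by rewrite addr_ge0// divr_ge0// ltW.
exists (1 + M / l) => // xi lxi A mA.
have xi0 : 0 < xi by exact: lt_le_trans lxi.
rewrite -(stationary_measure_invariant xi0 lxi)//.
apply: (dominated_markov_step (stat xi) C0 (dom l xi xi0 _)) => //.
exact/andP.
Qed.

Lemma lyapunovE xi : lam xi = (\int[stat xi]_x f x)%E.
Proof. by rewrite /lyapunov integral_mkcond. Qed.

Lemma stationary_log_integrable xi : l <= xi -> (stat xi).-integrable setT f.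
Proof.
move=> lxi; have [M M0 dom] := stationary_measure_dominated.
exact: dominated_integrable M0 (dom _ lxi) phase_uniform_log.1.
Qed.

Lemma lyapunov_fin_num xi : l <= xi -> lam xi \is a fin_num.
Proof.
move=> lxi; rewrite lyapunovE.
exact: integrable_fin_num (stationary_log_integrable lxi).
Qed.

Lemma lyapunov_well_defined_large xi : l <= xi ->
  lyapunov_well_defined T rho bc mu0 xi.
Proof.
move=> lxi; have xi0 : 0 < xi by exact: lt_le_trans lxi.
split=> [_|]; first exact: unique_stationary_of_invariant (@noise_kernel_unique _ xi0 lxi).
apply/(integrable_mkcond _ (@measurable_phase R)).
exact: stationary_log_integrable.
Qed.

Lemma lyapunov_seq_continuous (xi_ : nat -> R) xi b :
  (forall n, l <= xi_ n <= b) -> xi_ n @[n --> \oo] --> xi -> l <= xi ->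
  fine (lam (xi_ n)) @[n --> \oo] --> fine (lam xi).
Proof.
move=> lb cxi lxi; have [M M0 dom] := stationary_measure_dominated.
have l_xi n : l <= xi_ n by have /andP[] := lb n.
have xi0 : 0 < xi by exact: lt_le_trans lxi.
have xi_0 n : 0 < xi_ n by exact: lt_le_trans (l_xi n).
have cvg_stat : setwise_cvg \oo (fun n => stat (xi_ n)) (stat xi).
  apply: (@invariant_setwise_continuous _ _ _ U (fun n => kernel (xi_0 n))
    (kernel xi0) M (fun n => stat (xi_ n)) (stat xi) M0).
  - by move=> n; exact: dom.
  - by move=> n; exact: stationary_measure_invariant.
  - exact: stationary_measure_invariant.
  - exact: noise_kernel_unique.
  - move=> A e mA e0.
    have unif := noise_transition_uniform bc Hrho l0 lb cxi lxi mA e0.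
    by near=> n => x; exact: (near unif n).
have cvgf : fine (\int[stat (xi_ n)]_x f x)%E @[n --> \oo] -->
    fine (\int[stat xi]_x f x)%E.
  exact: (setwise_cvg_integral _ M0 (fun n => dom _ (l_xi n)) (dom _ lxi)
    cvg_stat phase_uniform_log.1).
rewrite [X in _ --> fine X]lyapunovE; apply: cvg_trans cvgf.
by apply: near_eq_cvg; near=> n; rewrite lyapunovE.
Unshelve. all: end_near. Qed.

Lemma lyapunov_continuous xi : l < xi -> {for xi, continuous lam}.
Proof.
move=> lxi; rewrite /prop_for /continuous_at.
have near_l : \forall y \near xi, l <= y by exact: (cvgr_ge xi cvg_id).
rewrite -(fineK (lyapunov_fin_num (ltW lxi))).
apply/fine_cvgP; split.
  by apply: filterS near_l => y; exact: lyapunov_fin_num.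
apply: contrapT => ncvg.
have [e [e0 nnear]] : exists e, 0 < e /\
    ~ \forall y \near xi, `|fine (lam xi) - fine (lam y)| < e.
  apply: contrapT => h; apply: ncvg; apply/cvgrPdist_lt => e e0.
  by apply: contrapT => h'; apply: h; exists e.
have bad n : exists y, [/\ l <= y, `|xi - y| < n.+1%:R^-1 &
    e <= `|fine (lam xi) - fine (lam y)|].
  apply: contrapT => h; apply: nnear.
  have near_n : \forall y \near xi, `|xi - y| < n.+1%:R^-1.
    by apply: nbhsx_ballx; rewrite invr_gt0.
  near=> y; rewrite ltNge; apply/negP => ey; apply: h; exists y.
  by split => //; near: y.
have [xi_ xi_P] := choice bad.
have cxi : xi_ n @[n --> \oo] --> xi.
  apply/cvgrPdist_lt => d d0.
  have /cvgrPdist_lt/(_ d d0) h := @cvg_harmonic R.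
  near=> n; have [_ h1 _] := xi_P n; apply: lt_trans h1 _.
  have : `|0 - harmonic n| < d :> R by near: n.
  by rewrite sub0r normrN; apply: le_lt_trans; exact: ler_norm.
have lb n : l <= xi_ n <= xi + 1.
  have [lx h _] := xi_P n; rewrite lx /=.
  have q1 : n.+1%:R^-1 <= 1 :> R by rewrite invf_le1 ?ler1n.
  have := lt_le_trans h q1; rewrite ltr_norml => /andP[h1 _]; lra.
have /cvgrPdist_lt/(_ e e0) h := lyapunov_seq_continuous lb cxi (ltW lxi).
have [n] := filter_ex h.
by have [_ _] := xi_P n; rewrite leNgt => /negP.
Unshelve. all: end_near. Qed.

Lemma lyapunov_limit : exists2 xi, l < xi & (lam xi < 0)%E.
Proof.
pose xi_ n := l + n.+1%:R.
have lxi_ n : l < xi_ n by rewrite ltrDl.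
have xi_0 n : 0 < xi_ n by exact: lt_trans (lxi_ n).
have [M M0 dom] := stationary_measure_dominated.
have [C C0 mix] := noise_transition_mixing bc Hrho.
have domU : dominated_by U (1 + M) U.
  move=> A mA; rewrite -[leLHS]mul1e lee_wpmul2r ?measure_ge0//.
  by rewrite lee_fin lerDl.
have domS n : dominated_by U (1 + M) (stat (xi_ n)).
  move=> A mA; apply: le_trans (dom _ (ltW (lxi_ n)) _ mA) _.
  by rewrite lee_wpmul2r ?measure_ge0// lee_fin lerDr.
have M10 : 0 <= 1 + M by rewrite addr_ge0.
have close n A : measurable A ->
    `|fine (U A) - fine (stat (xi_ n) A)| <= C / xi_ n.
  move=> mA; have inv := stationary_measure_invariant (xi_0 n) (ltW (lxi_ n)).
  have fU := fin_num_measure U _ mA; have fS := fin_num_measure (stat (xi_ n)) _ mA.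
  have bound x : `|fine (U A) - fine (kernel (xi_0 n) x A)| <= C / xi_ n.
    by apply: mix => //; exact: phase_map_phase.
  have fk x : kernel (xi_0 n) x A \is a fin_num.
    exact: noise_transition_fin_num.
  have le1 : (stat (xi_ n) A <= (fine (U A) + C / xi_ n)%:E)%E.
    rewrite -(inv _ mA) -[leRHS](integral_probability_cst (stat (xi_ n))).
    apply: ge0_le_integral => //; first exact: measurable_kernel.
    move=> x _; rewrite -(fineK (fk x)) /= lee_fin.
      by have := bound x; rewrite ler_norml => /andP[]; lra.
  have le2 : ((fine (U A) - C / xi_ n)%:E <= stat (xi_ n) A)%E.
    have [neg|pos] := ltP (fine (U A) - C / xi_ n) 0.
      by apply: le_trans (measure_ge0 _ _); rewrite lee_fin ltW.
    rewrite -(inv _ mA) -[leLHS](integral_probability_cst (stat (xi_ n))).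
    apply: ge0_le_integral => //; first exact: measurable_kernel.
    move=> x _; rewrite -(fineK (fk x)) /= lee_fin.
      by have := bound x; rewrite ler_norml => /andP[]; lra.
  move: le1 le2; rewrite -(fineK fS) !lee_fin => le1 le2.
  by rewrite ler_norml; apply/andP; split; lra.
have cvg_stat : setwise_cvg \oo (fun n => stat (xi_ n)) U.
  move=> A mA; apply/cvgrPdist_le => e e0.
  have Ce0 : 0 < e / (C + 1) by rewrite divr_gt0// ltr_wpDl.
  have /cvgrPdist_lt/(_ _ Ce0) h := @cvg_harmonic R.
  near=> n; apply: le_trans (close n A mA) _.
  have : `|0 - harmonic n| < e / (C + 1) :> R by near: n.
  rewrite sub0r normrN => /(le_lt_trans (ler_norm _)) hn.
  apply: (@le_trans _ _ ((C + 1) * n.+1%:R^-1)).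
    apply: ler_pM => //; first by rewrite invr_ge0 ltW.
      by rewrite lerDl.
    by rewrite lef_pV2 ?posrE// lerDr ltW.
  by rewrite mulrC -ler_pdivlMr ?ltW// ltr_wpDl.
have cvgf : fine (\int[stat (xi_ n)]_x f x)%E @[n --> \oo] --> fine (\int[U]_x f x)%E.
  exact: (setwise_cvg_integral _ M10 domS domU cvg_stat phase_uniform_log.1).
have fin_f := integrable_fin_num measurableT phase_uniform_log.1.
have neg : fine (\int[U]_x f x)%E < 0.
  rewrite -lte_fin fineK// phase_uniform_log.2.
  by case/andP: log_neg.
have near_neg : \forall n \near \oo, fine (\int[stat (xi_ n)]_x f x)%E < 0.
  exact: cvgr_lt cvgf _ neg.
have [n hn] := filter_ex near_neg.
exists (xi_ n) => //; rewrite -(fineK (lyapunov_fin_num (ltW (lxi_ n)))) lte_fin.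
by rewrite lyapunovE.
Unshelve. all: end_near. Qed.

Lemma stationary_measure_density xi : l <= xi ->
  exists g, is_density (stat xi) g.
Proof.
move=> lxi; have [M M0 dom] := stationary_measure_dominated.
pose nu : {charge set (measurableTypeR R) -> \bar R} :=
  charge_of_finite_measure (stat xi).
have nuleb : nu `<< leb.
  apply/null_content_dominatesP => A mA A0; apply/eqP.
  rewrite eq_le; apply/andP; split; last exact: measure_ge0.
  apply: le_trans (dom _ lxi _ mA) _.
  rewrite [X in (_ * X)%E](_ : _ = 0%E) ?mule0//.
  rewrite [LHS]phase_uniformE// (_ : leb _ = 0%E) ?mule0//.
  apply: (subset_measure0 _ _ _ A0) => //.
  by apply: measurableI => //; exact: measurable_phase.
pose g := Radon_Nikodym nu leb.
have gfin x : g x \is a fin_num by exact: Radon_Nikodym_fin_num.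
exists (fine \o g); split.
  apply: (eq_integrable _ g) => //; first exact: measurable_phase.
    by move=> x _; rewrite /= fineK.
  apply: (integrableS measurableT) => //; first exact: measurable_phase.
  exact: Radon_Nikodym_integrable.
move=> A mA Ap; rewrite /fun_measure setIidr//.
transitivity (\int[leb]_(x in A) g x)%E; last first.
  by apply: eq_integral => x _; rewrite /= fineK.
exact: (Radon_Nikodym_integral nuleb mA).
Qed.

End lyapunov.

Theorem theorem1p1p6 (R : realType) (T rho : R -> R) (bc : boundary)
    (mu0 : lineProb R) (f0 : R -> R) (p : R) (xi0 xi1 C theta : R)
    (T_phase : forall x, phase x -> phase (T x))
    (T_C1 : piecewise_C1 (-1) 1 T)
    (T_nonsingular : nonsingular T)
    (D1 : [/\ ac_invariant T mu0,
              forall nu : lineProb R, ac_invariant T nu ->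
                same_measure nu mu0 &
              is_density mu0 f0])
    (D2 : (0 < \int[mu0]_(x in phase) log_deriv T x)%E)
    (D3 : 1 < p /\ in_Lp p (log_deriv T))
    (R1 : [/\ 0 < xi0,
              forall xi, 0 <= xi < xi0 ->
                lyapunov_well_defined T rho bc mu0 xi &
              {within [set xi | 0 <= xi < xi0],
                continuous (lyapunov T rho bc mu0)}])
    (R2 : [/\ 0 <= xi1 < xi0, 0 < C, theta < 1 &
              forall n, (zero_average_opnorm (iter n (annealed_pf T rho bc xi1))
                         <= (C * theta ^+ n)%:E)%E])
    (R3 : (-oo < \int[lebesgue_measure]_(x in phase) (log_deriv T x * (2^-1)%:E) < 0)%E)
    (R4 : mother_noise_kernel rho) :
  [/\ forall xi, 0 <= xi -> lyapunov_well_defined T rho bc mu0 xi,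
      {within [set xi | 0 <= xi], continuous (lyapunov T rho bc mu0)} &
      noise_induced_order T rho bc mu0].
Proof.
have [xi00 wd0 cont0] := R1.
have [_ [mlog _]] := D3.
have unique_small l : 0 < l < xi0 -> has_unique_stationary T rho bc l.
  move=> /andP[l0 lxi].
  have l0xi : 0 <= l < xi0 by rewrite (ltW l0).
  by have [+ _] := wd0 l l0xi; apply; rewrite gt_eqF.
pose h := xi0 / 2.
have h0 : 0 < h by rewrite divr_gt0.
have hxi0 : h < xi0 by rewrite /h; lra.
have unique_h : has_unique_stationary T rho bc h by apply: unique_small; rewrite h0.
have wd xi : 0 <= xi -> lyapunov_well_defined T rho bc mu0 xi.
  move=> xi_ge0; have [lt|ge] := ltP xi xi0; first by apply: wd0; rewrite xi_ge0.
  apply: (lyapunov_well_defined_large mu0 T_phase T_C1 R4 mlog R3 h0 unique_h).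
  exact: le_trans (ltW hxi0) ge.
have cont : {within [set xi | 0 <= xi], continuous (lyapunov T rho bc mu0)}.
  apply/subspace_continuousP => x /= x0.
  have [xxi0|xi0x] := ltP x xi0.
    move/subspace_continuousP : cont0 => /(_ x).
    rewrite /= x0 xxi0 => /(_ isT) cont0.
    apply: cvg_trans cont0 => A; rewrite /nbhs /= /within /= => nA.
    have near_lt : \forall y \near x, y < xi0 by exact: (cvgr_lt x cvg_id).
    near=> y => y0; have yxi0 : y < xi0 by near: y.
    by apply: (near nA y) => //; rewrite y0.
  apply: cvg_within_filter.
  exact: (lyapunov_continuous T_phase T_C1 R4 mlog R3 h0 unique_h (lt_le_trans hxi0 xi0x)).
split => //.
have lam0 : (0 < lyapunov T rho bc mu0 0)%E by rewrite /lyapunov /stationary_measure eqxx.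
have [xi' xi'0 [xi'xi0 lam'0]] : exists2 xi', 0 < xi' &
    xi' < xi0 /\ (0 < lyapunov T rho bc mu0 xi')%E.
  move/subspace_continuousP : cont0 => /(_ 0); rewrite /= lexx xi00 => /(_ isT) cont00.
  have nearpos : \forall y \near 0, 0 <= y < xi0 -> (0 < lyapunov T rho bc mu0 y)%E.
    apply: (cont00 [set z | (0 < z)%E]).
    by apply: open_nbhs_nbhs; split => //; exact: open_ereal_gt_ereal.
  have [d /= d0 dpos] := nearpos.
  pose y := Num.min (d / 2) h.
  have y0 : 0 < y by rewrite lt_min h0 divr_gt0.
  have yh : y <= h by rewrite ge_min lexx orbT.
  have yd : y <= d / 2 by rewrite ge_min lexx.
  exists y; first exact: y0.
  split; first exact: le_lt_trans yh hxi0.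
  apply: dpos; last by rewrite (ltW y0) (le_lt_trans yh).
  by rewrite /ball_ /= sub0r normrN gtr0_norm//; lra.
have unique_xi' : has_unique_stationary T rho bc xi'.
  by apply: unique_small; rewrite xi'0.
have [xi'' xi'xi'' lam''0] :=
  lyapunov_limit mu0 T_phase T_C1 R4 mlog R3 xi'0 unique_xi'.
exists xi', xi''; split => //.
- by rewrite xi'0.
- move=> xi xi'xi; split; first by apply: wd; exact: le_trans (ltW xi'0) xi'xi.
  exact: (stationary_measure_density mu0 T_phase T_C1 R4 xi'0 unique_xi').
- apply: continuous_subspaceW cont => y /= xi'y.
  exact: le_trans (ltW xi'0) xi'y.
Unshelve. all: end_near. Qed.
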